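(* Let $n$ be a positive integer, let $G$ be a connected graph with at least $n$ vertices and minimum degree $\delta(G)\geq n-3$, and let $T_n$ be a tree with $n$ vertices and maximum degree $\Delta(T_n)\leq n-3$. Then $T_n$ can be embedded into $G$ if and only if neither of the following situations happens: (i) $G$ is isomorphic to $K_{n-3,n-3}$ and $T_n$ is isomorphic to $T(p,n-3-p)$ for some integer $p\geq 1$; (ii) $G$ is isomorphic to a balanced complete $(k+1)$-partite graph with $a$ vertices in each part, where $k\geq 2$ and $a$ are positive integers with $ka=n-3$, and $T_n$ is isomorphic to $T(1,n-4)$.
   Context: All graphs are simple. A graph $F$ can be embedded into a graph $G$ if there is an injection $\phi:V(F)\to V(G)$ such that $\phi(x)\phi(y)\in E(G)$ for every edge $xy\in E(F)$ (i.e. $G$ contains a copy of $F$ as a subgraph). For positive integers $p,q$, $T(p,q)$ denotes the tree having a longest path $v_1v_2v_3v_4v_5$ with $d(v_3)=2$, where $v_2$ is adjacent to exactly $p$ leaves and $v_4$ is adjacent to exactly $q$ leaves; equivalently, $T(p,q)$ consists of a vertex $v_3$ adjacent to exactly two vertices $v_2,v_4$, where $v_2$ has $p$ further neighbours that are leaves and $v_4$ has $q$ further neighbours that are leaves (so $T(p,q)$ has $p+q+3$ vertices). *)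

(* Defs.v *)
From mathcomp Require Import all_boot.

Set Implicit Arguments.
Unset Strict Implicit.
Unset Printing Implicit Defensive.

Record sgraph := SGraph {
  vertex :> finType;
  edge : rel vertex;
  edge_sym : symmetric edge;
  edge_irrefl : irreflexive edge
}.

Definition embeds (F G : sgraph) : Prop :=
  exists2 phi : F -> G, injective phi &
    forall x y : F, edge x y -> edge (phi x) (phi y).

Definition isomorphic (F G : sgraph) : Prop :=
  exists2 phi : F -> G, bijective phi &
    forall x y : F, edge (phi x) (phi y) = edge x y.

Definition degree (G : sgraph) (x : G) : nat := #|[set y : G | edge x y]|.

(* Every degree is less than #|G|, so the neutral element #|G| only shows up
   for the empty graph. *)
Definition min_degree (G : sgraph) : nat :=
  \big[minn/#|G|]_(x : G) degree x.

Definition max_degree (G : sgraph) : nat := \max_(x : G) degree x.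

Definition connected_graph (G : sgraph) : Prop :=
  0 < #|G| /\ forall x y : G, connect (@edge G) x y.

(* A closed walk x, y, x is a ucycle of size 2, so genuine cycles are those of
   size at least 3. *)
Definition acyclic_graph (G : sgraph) : Prop :=
  forall c : seq G, ucycle (@edge G) c -> size c < 3.

Definition is_tree (G : sgraph) : Prop :=
  connected_graph G /\ acyclic_graph G.

Definition bip_edge (m n : nat) : rel ('I_m + 'I_n)%type := fun x y =>
  match x, y with
  | inl _, inr _ | inr _, inl _ => true
  | _, _ => false
  end.

Lemma bip_edge_sym (m n : nat) : symmetric (@bip_edge m n).
Proof. by case=> x [] y. Qed.

Lemma bip_edge_irrefl (m n : nat) : irreflexive (@bip_edge m n).
Proof. by case. Qed.

Definition complete_bipartite (m n : nat) : sgraph :=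
  SGraph (@bip_edge_sym m n) (@bip_edge_irrefl m n).

(* The balanced complete r-partite graph: (i, u) is the u-th vertex of part i. *)
Definition multi_edge (r a : nat) : rel ('I_r * 'I_a)%type :=
  fun x y => x.1 != y.1.

Lemma multi_edge_sym (r a : nat) : symmetric (@multi_edge r a).
Proof. by move=> x y; rewrite /multi_edge eq_sym. Qed.

Lemma multi_edge_irrefl (r a : nat) : irreflexive (@multi_edge r a).
Proof. by move=> x; rewrite /multi_edge eqxx. Qed.

Definition balanced_multipartite (r a : nat) : sgraph :=
  SGraph (@multi_edge_sym r a) (@multi_edge_irrefl r a).

(* T(p, q), meant for p, q > 0: the ordinals 0, 1, 2 are v_2, v_3, v_4;
   the 'I_p are the leaves at v_2 and the 'I_q the leaves at v_4. *)
Definition treeT_arc (p q : nat) : rel ('I_3 + ('I_p + 'I_q))%type := fun x y =>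
  match x, y with
  | inl i, inl j => i.+1 == j :> nat
  | inl i, inr (inl _) => i == 0 :> nat
  | inl i, inr (inr _) => i == 2 :> nat
  | inr _, _ => false
  end.

Definition treeT_edge (p q : nat) : rel ('I_3 + ('I_p + 'I_q))%type :=
  fun x y => treeT_arc x y || treeT_arc y x.

Lemma treeT_edge_sym (p q : nat) : symmetric (@treeT_edge p q).
Proof. by move=> x y; rewrite /treeT_edge orbC. Qed.

Lemma treeT_edge_irrefl (p q : nat) : irreflexive (@treeT_edge p q).
Proof. by case=> [i|//]; rewrite /treeT_edge /= orbb gtn_eqF. Qed.

Definition treeT (p q : nat) : sgraph :=
  SGraph (@treeT_edge_sym p q) (@treeT_edge_irrefl p q).

(* Main.v *)
Require Import Defs.
From mathcomp Require Import all_boot.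
From mathcomp Require Import zify.
From Stdlib Require Import Classical.

(** Write d = n - 3.  Removing from T a set D of two vertices (two leaves at one
    vertex h, or a leaf together with its degree-2 neighbour, whose other
    neighbour is h) leaves a tree with d + 1 vertices, which embeds greedily from
    any prescribed start around h.  If h goes to v, then each unit of excess
    degree of v and each used vertex not adjacent to v yields a free neighbour of
    v; two free neighbours suffice to place D back.  So G may be taken d-regular,
    and it remains to start from two vertices at distance at least 2 from h, both
    sent to non-neighbours of v.  In a connected d-regular graph this works along
    two branches at h, or along a fork.  Otherwise T contains a path h, a, b, c
    and it works unless non-adjacency is transitive, i.e. G is complete
    multipartite.  There the only failures are T(p, q) in K_(d,d) and T(1, d - 1)
    in a balanced complete multipartite graph. *)

Set Implicit Arguments.
Unset Strict Implicit.
Unset Printing Implicit Defensive.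

Lemma card_setU1_le (T : finType) (x : T) (A : {set T}) : #|x |: A| <= #|A|.+1.
Proof. by rewrite cardsU1 -addn1 addnC leq_add2l leq_b1. Qed.

(** * Induced paths in connected graphs and in connected regular graphs *)

Section Graph.
Variable G : sgraph.
Implicit Types (x y a c g s t v w : G) (X : {set G}).

Definition nb x : {set G} := [set y | edge x y].

Lemma in_nb x y : (y \in nb x) = edge x y.
Proof. by rewrite inE. Qed.

Lemma edge_neq x y : edge x y -> x != y.
Proof. by apply: contraTneq => ->; rewrite edge_irrefl. Qed.

Hypothesis conn : connected_graph G.

Lemma edge_leaving X x y :
  x \in X -> y \notin X -> exists s w, [/\ s \in X, w \notin X & edge s w].
Proof.
move=> xX yX; apply: NNPP => none.
have /connectP[p xp yE] := conn.2 x y.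
move: yX; rewrite yE; elim: p x xX xp {yE} => [|z p IHp] x xX /=; first by rewrite xX.
case/andP=> xz; apply: IHp; apply/negPn/negP=> zX.
by case: none; exists x, z.
Qed.

Lemma closed_setT X x :
  x \in X -> (forall s w, s \in X -> edge s w -> w \in X) -> X = setT.
Proof.
move=> xX clX; apply/setP=> y; rewrite inE; apply/negPn/negP=> yX.
have [s [w [sX wX sw]]] := edge_leaving xX yX.
by rewrite (clX s w) in wX.
Qed.

(** The closed neighbourhood of v is not the whole graph, so an edge leaves it; this edge cannot
    start at v, hence starts at a neighbour of v. *)
Lemma induced_path2 v : #|nb v| + 1 < #|G| ->
  exists s w, [/\ edge v s, edge s w, w != v & ~~ edge v w].
Proof.
move=> small; have [y yP] : exists y, y \notin v |: nb v.
  apply/existsP; rewrite -negb_forall; apply: contraL small => /forallP all.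
  (* The successor is read as [true + _] so that [cardsU1] turns it into the cardinal of the closed
     neighbourhood. *)
  rewrite -leqNgt addn1 -[(#|_|).+1]/(true + #|nb v|)%N.
  suff -> : true = (v \notin nb v) by rewrite -cardsU1; apply/subset_leq_card/subsetP.
  by rewrite in_nb edge_irrefl.
have [s [w [sX]]] := edge_leaving (setU11 v _) yP.
rewrite !inE negb_or => /andP[wv vw] sw; exists s, w; split=> //.
by move: sX; rewrite !inE => /predU1P[] // sv; rewrite -sv sw in vw.
Qed.

Section Regular.
Variable d : nat.
Hypotheses (reg : forall x, #|nb x| = d) (big : d + 3 <= #|G|).

(** If v missed g, its neighbours would be among s, t and the neighbours of s other than v, w, g: at
    most d - 1 vertices. *)
Lemma common_nb_bound s v w t : edge s v -> edge s w -> v != w -> ~~ edge v w ->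
  (forall t1, edge v t1 -> ~~ edge s t1 -> t1 != s -> t1 = t) ->
  forall g, edge s g -> g != v -> g != w -> edge v g.
Proof.
move=> sv sw vw nvw one g sg gv gw; apply/negPn/negP=> nvg.
have vs : edge v s by rewrite edge_sym.
have sub : nb v \subset t |: (s |: (nb s :\ v :\ w :\ g)).
  apply/subsetP=> x; rewrite !inE => vx.
  case: (eqVneq x s) => [->|xs]; first by rewrite orbT.
  case: (boolP (edge s x)) => [sx|nsx].
    rewrite !(contraTneq _ vx) ?orbT //.
    - by move=> ->; rewrite edge_irrefl.
    - by move=> ->.
    - by move=> ->.
  by rewrite (one x) ?eqxx.
have := leq_trans (subset_leq_card sub) (card_setU1_le _ _); rewrite reg.
have := card_setU1_le s (nb s :\ v :\ w :\ g).
have := reg s; rewrite (cardsD1 v) (cardsD1 w) (cardsD1 g) !inE sv sw sg.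
rewrite gw gv eq_sym vw /=; clear; lia.
Qed.

(** Otherwise the neighbours of v lie among s and the neighbours of s other than v and w, which are
    only d - 1 vertices. *)
Lemma outside_nb s v w : edge s v -> edge s w -> v != w -> ~~ edge v w ->
  exists t, [/\ edge v t, ~~ edge s t & t != s].
Proof.
move=> sv sw vw nvw; apply: NNPP => none.
have sub : nb v \subset s |: (nb s :\ v :\ w).
  apply/subsetP=> x; rewrite !inE => vx.
  case: (eqVneq x s) => //= xs.
  case: (boolP (edge s x)) => [sx|nsx].
    by rewrite andbT !(contraTneq _ vx) // => ->; rewrite ?edge_irrefl.
  by case: none; exists x.
have := leq_trans (subset_leq_card sub) (card_setU1_le _ _); rewrite reg.
have := reg s; rewrite (cardsD1 v) (cardsD1 w) !inE sv sw eq_sym vw /=; clear; lia.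
Qed.

(* If this fails, then any two vertices v, w at distance 2 have the same
   neighbours, and N(v) together with v and w is closed under adjacency. *)
Lemma two_branches : exists s v w t t',
  [/\ [/\ edge s v, edge s w, v != w & ~~ edge v w], edge v t, edge w t', t != t' &
      [/\ t != s, ~~ edge s t, t' != s & ~~ edge s t']].
Proof.
apply: NNPP => none.
have same s v w t t' : edge s v -> edge s w -> v != w -> ~~ edge v w ->
  edge v t -> edge w t' -> t != s -> ~~ edge s t -> t' != s -> ~~ edge s t' -> t = t'.
  move=> *; apply/eqP/negPn/negP=> tt'; case: none; exists s, v, w, t, t'.
  by repeat split.
have sub v w : v != w -> ~~ edge v w -> forall s, edge s v -> edge s w ->
    (forall g, edge s g -> g != v -> g != w -> edge v g) /\
    (forall g, edge w g -> edge v g).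
  move=> vw nvw s sv sw; have nwv : ~~ edge w v by rewrite edge_sym.
  have wv : w != v by rewrite eq_sym.
  have [t' [wt' nst' t's]] := outside_nb sw sv wv nwv.
  have [t [vt nst ts]] := outside_nb sv sw vw nvw.
  have A : forall g, edge s g -> g != v -> g != w -> edge v g.
    apply: (@common_nb_bound s v w t') => // t1 vt1 nst1 t1s.
    exact: (same s v w).
  split=> // g wg; case: (eqVneq g s) => [->|gs]; first by rewrite edge_sym.
  case: (boolP (edge s g)) => sg.
    by apply: A; rewrite // (contraTneq _ wg) // => ->; rewrite ?edge_irrefl.
  by rewrite -(same s v w t g).
have /card_gt0P[v _] : 0 < #|G| by lia.
have [|s [w [vs sw wv nvw]]] := @induced_path2 v; first by rewrite reg; lia.
have vw : v != w by rewrite eq_sym.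
have sv : edge s v by rewrite edge_sym.
have nwv : ~~ edge w v by rewrite edge_sym.
have nbE g : edge v g = edge w g.
  by apply/idP/idP; [case: (sub w v wv nwv s sw sv) | case: (sub v w vw nvw s sv sw)] => _; apply.
have full : v |: (w |: nb v) = setT.
  apply: (closed_setT (setU11 _ _)) => a g; rewrite !inE => /or3P[/eqP->|/eqP->|va] ag.
  - by rewrite ag !orbT.
  - by rewrite nbE ag !orbT.
  - have aw : edge a w by rewrite edge_sym -nbE.
    have av : edge a v by rewrite edge_sym.
    case: (eqVneq g v) => //= gv; case: (eqVneq g w) => //= gw.
    by case: (sub v w vw nvw a av aw) => + _; apply.
(* The whole graph would have at most d + 2 vertices, against [big]. *)
have := cardsT G; rewrite -full; move: big (card_setU1_le v (w |: nb v)) (card_setU1_le w (nb v)).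
by rewrite reg; clear; lia.
Qed.

(** Suppose that for every edge v s at most one neighbour of s is at distance 2 from v. On the path
    t, v, s, w, t' given by [two_branches], a third neighbour c of v is then forced to be adjacent
    to s, to w and to t'. Now w and t' are two neighbours of c at distance 2 from v. *)
Lemma two_private_nb : 3 <= d -> exists v s w w',
  [/\ edge v s, edge s w, edge s w', w != w' & [/\ w != v, ~~ edge v w, w' != v & ~~ edge v w']].
Proof.
move=> d3; apply: NNPP => none.
have same v s w w' : edge v s -> edge s w -> edge s w' -> w != v -> ~~ edge v w ->
    w' != v -> ~~ edge v w' -> w = w'.
  move=> *; apply/eqP/negPn/negP=> ww'; case: none; exists v, s, w, w'.
  by repeat split.
have [s [v [w [t [t' [[sv sw vw nvw] vt wt' tt' [ts nst t's nst']]]]]]] := two_branches.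
have vs : edge v s by rewrite edge_sym.
have ws : edge w s by rewrite edge_sym.
have nwv : ~~ edge w v by rewrite edge_sym.
have [c [vc cs ct]] : exists c, [/\ edge v c, c != s & c != t].
  have := reg v; rewrite (cardsD1 s) (cardsD1 t) !inE vs vt ts /= => card.
  have /card_gt0P[c] : 0 < #|nb v :\ s :\ t| by move: card; clear -d3; lia.
  by rewrite !inE => /and3P[ct cs vc]; exists c.
have sc : edge s c.
  apply/negPn/negP=> nsc; case/eqP: ct; exact: (same s v).
have cw : c != w by apply: contraTneq vc => ->.
have cv : c != v by rewrite eq_sym edge_neq.
have wc : edge w c.
  by apply/negPn/negP=> nwc; case/eqP: cv; apply: (same w s).
have ct' : c != t' by apply: contraTneq sc => ->.
have t'c : edge t' c.
  apply/negPn/negP=> nt'c; case/eqP: cs; apply: (same t' w); rewrite // 1?eq_sym //.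
  - by rewrite edge_sym.
  - by rewrite edge_sym.
have nvt' : ~~ edge v t'.
  by apply/negP=> vt'; case/eqP: tt'; apply: (same s v).
have wt'n : w != t' by exact: edge_neq.
case/eqP: wt'n; apply: (same v c); rewrite // 1?[edge c _]edge_sym 1?eq_sym //.
by apply: contraTneq sv => ->.
Qed.

End Regular.

End Graph.

(** * Subtrees and depth in a tree *)

Section Tree.
Variable T : sgraph.
Hypothesis tree : is_tree T.
Implicit Types (a b c e p q r x y z : T) (D Q : {set T}).

Definition leaf_at x y := edge x y /\ forall g, edge x g -> g = y.

(** The connected vertex sets containing r, presented by an order of growth so that embeddings and
    depths can be built by induction. *)
Inductive subtree r : {set T} -> Prop :=
| subtree1 : subtree r [set r]
| subtreeU Q p q : subtree r Q -> p \in Q -> q \notin Q -> edge p q -> subtree r (q |: Q).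

Lemma subtree_root r Q : subtree r Q -> r \in Q.
Proof. by elim=> [|Q' p q _ rQ' _ _ _]; rewrite !inE ?rQ' ?orbT ?eqxx. Qed.

Lemma subtree_connect r Q : subtree r Q ->
  {in Q, forall x, connect [rel a b | [&& edge a b, a \in Q & b \in Q]] r x}.
Proof.
elim=> [|Q' p q _ IH pQ qQ pq] x; first by rewrite inE => /eqP->.
have mono y : y \in Q' ->
    connect [rel a b | [&& edge a b, a \in q |: Q' & b \in q |: Q']] r y.
  move/IH; apply: connect_sub => a b /and3P[ab aQ bQ].
  by apply: connect1; rewrite /= ab !inE aQ bQ !orbT.
case/setU1P=> [->|]; last exact: mono.
by apply: connect_trans (mono p pQ) (connect1 _); rewrite /= pq !inE eqxx pQ orbT.
Qed.

(** A simple path inside Q from a to b, closed up through q, would be a cycle; acyclicity leaves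
    only the path of length 0. *)
Lemma subtree_nb_uniq r Q q a b : subtree r Q -> q \notin Q ->
  a \in Q -> b \in Q -> edge q a -> edge q b -> a = b.
Proof.
move=> stQ qQ aQ bQ qa qb; set eQ := [rel a b | [&& edge a b, a \in Q & b \in Q]].
have sym : connect_sym eQ.
  by apply: sym_connect_sym => x y; rewrite /= edge_sym [(x \in Q) && _]andbC.
have : connect eQ a b.
  apply: (@connect_trans _ _ r); last exact: (subtree_connect stQ).
  by rewrite sym; apply: (subtree_connect stQ).
case/connectP=> s /shortenP[s' ps' us' _] bE; apply: contraNeq (qQ) => ab.
have sQ : {subset a :: s' <= Q}.
  elim: s' a aQ ps' {us' bE ab qa} => [|y s' IH] a aQ /=.
    by move=> _ x; rewrite inE => /eqP->.
  case/andP=> /and3P[_ _ yQ] ps' x; rewrite inE => /predU1P[->//|].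
  exact: (IH y).
have pE : path (@edge T) a s' by apply: sub_path ps' => x y /and3P[].
have : size (q :: a :: s') < 3.
  apply: tree.2; apply/andP; split.
    by rewrite /= rcons_path pE qa -bE edge_sym qb.
  by rewrite cons_uniq us' andbT; apply: contra qQ => /sQ.
case: s' bE {us' ps' sQ pE} => [/= ba|//]; by rewrite ba eqxx in ab.
Qed.

(** Edges leaving D end in Q, so an edge leaving the union of D and Q starts in Q. Thus a subtree
    can be grown until it is everything but D, with D held back. *)
Lemma subtree_grow r Q D : subtree r Q ->
  (forall e g, e \in D -> edge e g -> g \in D :|: Q) ->
  D :|: Q = setT \/ exists p q, [/\ p \in Q, q \notin Q, q \notin D & edge p q].
Proof.
move=> stQ clD; case: (classic (exists p q, [/\ p \in Q, q \notin Q, q \notin D & edge p q])).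
  by right.
move=> none; left; have rDQ : r \in D :|: Q by rewrite inE (subtree_root stQ) orbT.
apply: (closed_setT tree.1 rDQ) => s w; rewrite in_setU => /orP[|sQ] sw; first exact: clD.
rewrite inE; apply/negPn/negP; rewrite negb_or => /andP[wD wQ].
by case: none; exists s, w.
Qed.

Lemma subtree_setT r : subtree r setT.
Proof.
suff: forall n Q, subtree r Q -> #|~: Q| <= n -> subtree r setT.
  by apply; first exact: subtree1.
elim=> [|n IHn] Q stQ; first by rewrite leqn0 cards_eq0 => /eqP QE; rewrite -setC0 -QE setCK.
have [|<-|[p [q [pQ qQ _ pq]]] small] := @subtree_grow r Q set0 stQ.
- by move=> e g; rewrite inE.
- by rewrite set0U.
- apply: (IHn (q |: Q)); first exact: subtreeU pq.
  have -> : ~: (q |: Q) = ~: Q :\ q by apply/setP=> x; rewrite !inE negb_or.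
  by move: small; rewrite (cardsD1 q) inE qQ.
Qed.

(** The distance from r, axiomatised by the properties that the arguments use instead of being
    defined by shortest paths. *)
Definition depth_function r (h : T -> nat) :=
  [/\ h r = 0,
      forall a b, edge a b -> h a = (h b).+1 \/ h b = (h a).+1,
      forall x y z, edge x y -> edge x z -> h y < h x -> h z < h x -> y = z &
      forall x, x != r -> exists2 y, edge x y & h x = (h y).+1].

(** The children of the parent y of x are as deep as x, hence are leaves at y, hence equal x because
    no two leaves share a neighbour; so y has degree 2. Since D hangs from r only, a vertex outside
    D at positive depth has no neighbour in D. *)
Lemma deepest_leaf r h D x : depth_function r h ->
  (forall e g, e \in D -> edge e g -> g \in r |: D) ->
  (forall b b' c, leaf_at b c -> leaf_at b' c -> b = b') ->
  x \notin D -> 1 < h x -> (forall b, b \notin D -> h b <= h x) ->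
  exists y z, [/\ leaf_at x y, y \notin D, y != r, edge y z & z != x /\
    forall g, edge y g -> g = x \/ g = z].
Proof.
move=> [h0 step anc par] clD lone xD hx deep.
have stay b g : b \notin D -> 0 < h b -> edge b g -> g \notin D.
  move=> bD hb bg; apply/negP=> gD; have := clD g b gD.
  rewrite edge_sym bg !inE (negbTE bD) orbF => /(_ isT) /eqP br.
  by rewrite br h0 in hb.
have leaf b g : b \notin D -> h b = h x -> edge b g -> h b = (h g).+1.
  move=> bD bx bg; case: (step _ _ bg) => // hg.
  have hb : 0 < h b by rewrite bx (ltn_trans _ hx).
  by have := deep g (stay b g bD hb bg); rewrite hg bx ltnn.
have [|y xy xhy] := par x; first by apply: contraTneq hx => ->; rewrite h0.
have hy : 0 < h y by rewrite -ltnS -xhy.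
have yr : y != r by apply: contraTneq hy => ->; rewrite h0.
have yD := stay x y xD (ltn_trans (ltn0Sn 0) hx) xy.
have [z yz yhz] := par y yr.
have lf b : b \notin D -> h b = h x -> edge b y -> leaf_at b y.
  move=> bD bx by_; split=> // g bg; apply: (anc b) => //.
    by rewrite (leaf b g) //.
  by rewrite (leaf b y) //.
exists y, z; split=> //; first exact: lf.
split=> [|g yg]; first by apply/eqP=> zx; rewrite zx xhy in yhz; move: yhz; clear; lia.
case: (step _ _ yg) => hg; [right | left].
  by apply: (anc y) => //; [rewrite hg | rewrite yhz].
apply: (lone g x y); apply: lf => //; rewrite 1?edge_sym ?hg ?xhy //.
exact: stay yg.
Qed.

Lemma depth_exists r : exists h, depth_function r h.
Proof.
(* The properties are relativised to a set so that induction along [subtree_setT] can attach one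
   vertex at a time, one level below its only neighbour in the set. *)
suff: exists h : T -> nat, [/\ h r = 0,
    {in setT &, forall a b, edge a b -> h a = (h b).+1 \/ h b = (h a).+1},
    {in setT & &, forall x y z, edge x y -> edge x z -> h y < h x -> h z < h x -> y = z} &
    {in setT, forall x, x != r -> exists2 y, y \in setT & edge x y /\ h x = (h y).+1}].
  case=> h [h0 h1 h2 h3]; exists h; split=> // [a b|x y z|x xr].
  - exact: h1.
  - exact: h2.
  - by have [//|y _ [xy hx]] := h3 x _ xr; exists y.
elim: (subtree_setT r) => [|Q p q stQ [h [h0 h1 h2 h3]] pQ qQ pq].
  exists (fun=> 0); split=> // [a b|x]; rewrite !inE.
    by move=> /eqP-> /eqP->; rewrite edge_irrefl.
  by move=> ->.
have qp : edge q p by rewrite edge_sym.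
have nbq x : x \in Q -> edge q x -> x = p.
  by move=> xQ qx; apply: (subtree_nb_uniq stQ qQ).
have neq x : x \in Q -> (x == q) = false by move=> xQ; apply: contraNF qQ => /eqP<-.
exists (fun x => if x == q then (h p).+1 else h x); split.
- by rewrite neq // (subtree_root stQ).
- move=> a b /setU1P[->|aQ] /setU1P[->|bQ]; rewrite ?eqxx ?neq //.
  + by rewrite edge_irrefl.
  + by move/(nbq _ bQ)->; left.
  + by rewrite edge_sym => /(nbq _ aQ)->; right.
  + exact: h1.
- move=> x y z /setU1P[->|xQ] /setU1P[->|yQ] /setU1P[->|zQ]; rewrite ?eqxx ?neq // ?edge_irrefl //.
  + by move=> /(nbq _ yQ)-> /(nbq _ zQ)->.
  + by rewrite edge_sym => /(nbq _ xQ)->; rewrite ltnNge leqnSn.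
  + by move=> _; rewrite edge_sym => /(nbq _ xQ)-> _; rewrite ltnNge leqnSn.
  + exact: h2.
- move=> x /setU1P[->|xQ]; rewrite ?eqxx ?neq // => xr.
    by exists p; rewrite ?inE ?pQ ?orbT // neq.
  have [y yQ [xy hx]] := h3 x xQ xr.
  by exists y; rewrite ?inE ?yQ ?orbT // neq.
Qed.

End Tree.

(** * Isomorphisms of graphs *)

Lemma inj_surj_bij (A B : finType) (f : A -> B) :
  injective f -> (forall y, exists x, f x = y) -> bijective f.
Proof.
move=> inj surj; apply: inj_card_bij => //.
rewrite -(card_codom inj); apply/subset_leq_card/subsetP=> y _.
by have [x <-] := surj y; apply: codom_f.
Qed.

Lemma isomorphic_sym (F G : sgraph) : isomorphic F G -> isomorphic G F.
Proof.
case=> phi [psi phiK psiK] hom; exists psi; first by exists phi.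
by move=> x y; rewrite -hom !psiK.
Qed.

Lemma isomorphic_embeds (F F' G G' : sgraph) :
  isomorphic F F' -> isomorphic G G' -> embeds F G -> embeds F' G'.
Proof.
move=> /isomorphic_sym[phi bphi hphi] [psi bpsi hpsi] [f injf homf].
exists (psi \o f \o phi); first by apply: inj_comp (bij_inj bphi); apply: inj_comp (bij_inj bpsi) injf.
by move=> x y xy /=; rewrite hpsi; apply: homf; rewrite hphi.
Qed.

(** * Regular graphs with transitive non-adjacency *)

Section Multipartite.
Variables (G : sgraph) (d : nat).
Hypotheses (reg : forall v : G, #|nb v| = d).
Hypothesis multi : forall v w w' : G, ~~ edge v w -> ~~ edge v w' -> ~~ edge w w'.
Implicit Types (s v w : G).

Lemma multi_edge_nb v s w : edge v s -> ~~ edge v w -> edge s w.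
Proof.
move=> vs nvw; apply: contraLR vs => nsw.
by apply: (multi (v := w)); rewrite edge_sym.
Qed.

(** An edge v s in no triangle leaves exactly two classes of non-adjacency, the neighbours of v and
    the neighbours of s, with d vertices each. *)
Lemma triangle_free_isomorphic v s : edge v s ->
  (forall w, edge v w -> ~~ edge s w) -> isomorphic G (complete_bipartite d d).
Proof.
move=> vs free; apply: isomorphic_sym.
have nbE w : edge s w = ~~ edge v w.
  by apply/idP/idP; [apply: contraL => /free | apply: multi_edge_nb].
pose psi (i : 'I_d + 'I_d) : G := match i with
  | inl j => enum_val (cast_ord (esym (reg v)) j)
  | inr j => enum_val (cast_ord (esym (reg s)) j) end.
have psi1 j : edge v (psi (inl j)) by rewrite -in_nb; apply: enum_valP.
have psi2 j : ~~ edge v (psi (inr j)) by rewrite -nbE -in_nb; apply: enum_valP.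
exists psi; first apply: inj_surj_bij => [[i|i] [j|j] eij|w].
- by rewrite (cast_ord_inj (enum_val_inj eij)).
- by have := psi2 j; rewrite -eij psi1.
- by have := psi2 i; rewrite eij psi1.
- by rewrite (cast_ord_inj (enum_val_inj eij)).
- case: (boolP (edge v w)) => vw.
    have wN : w \in nb v by rewrite in_nb.
    exists (inl (cast_ord (reg v) (enum_rank_in wN w))).
    by rewrite /psi cast_ordK enum_rankK_in.
  have wN : w \in nb s by rewrite in_nb nbE.
  exists (inr (cast_ord (reg s) (enum_rank_in wN w))).
  by rewrite /psi cast_ordK enum_rankK_in.
- move=> [i|i] [j|j].
  + by rewrite -[RHS]/false; apply/negbTE/(multi (v := s)); rewrite nbE psi1.
  + by rewrite -[RHS]/true; apply: (multi_edge_nb (psi1 i) (psi2 j)).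
  + by rewrite -[RHS]/true edge_sym; apply: (multi_edge_nb (psi1 j) (psi2 i)).
  + by rewrite -[RHS]/false; apply/negbTE/(multi (psi2 i) (psi2 j)).
Qed.

(** The classes of non-adjacency are the complements of neighbourhoods, so regularity makes them all
    of size [#|G| - d]. *)
Lemma multipartite_isomorphic : d < #|G| ->
  exists r, r * (#|G| - d) = #|G| /\ isomorphic G (balanced_multipartite r (#|G| - d)).
Proof.
move=> small; set c := #|G| - d.
pose cl v := ~: nb v; pose P := [set cl v | v : G].
have cl_self v : v \in cl v by rewrite !inE edge_irrefl.
have clE v w : (cl v == cl w) = ~~ edge v w.
  apply/eqP/idP=> [vw|nvw]; first by have := cl_self w; rewrite -vw !inE.
  apply/setP=> x; rewrite !inE; apply/idP/idP; first exact: multi.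
  by apply: multi; rewrite edge_sym.
have card_cl v : #|cl v| = c by rewrite /c -(reg v) -(cardsC (nb v)) addKn.
have clP (i : 'I_#|P|) : exists v, enum_val i = cl v.
  by have /imsetP[v _ ->] := enum_valP i; exists v.
have /card_gt0P[v0 _] : 0 < #|G| by apply: leq_trans small.
(* The default [v0] is never reached, as every class has exactly c elements. *)
pose psi (x : 'I_#|P| * 'I_c) : G := nth v0 (enum (enum_val x.1)) x.2.
have size_cl (i : 'I_#|P|) : size (enum (enum_val i)) = c.
  by have [v ->] := clP i; rewrite -cardE card_cl.
have psi_in x : psi x \in enum_val x.1 by rewrite -mem_enum mem_nth // size_cl.
have psiE x : cl (psi x) = enum_val x.1.
  have := psi_in x; have [v ->] := clP x.1.
  by rewrite !inE => nvx; apply/eqP; rewrite clE edge_sym.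
have bij : bijective psi.
  apply: inj_surj_bij => [[i j] [i' j'] /= eij|w].
    have ii' : i = i' by apply: enum_val_inj; rewrite -(psiE (i, j)) -(psiE (i', j')) eij.
    subst i'; congr (_, _); apply: val_inj; apply/eqP.
    rewrite -(nth_uniq v0 _ _ (enum_uniq (enum_val i))) ?size_cl ?ltn_ord //.
    exact/eqP.
  have wP : cl w \in P by apply: imset_f.
  have wlt : index w (enum (cl w)) < c by rewrite -(card_cl w) cardE index_mem mem_enum.
  exists (enum_rank_in wP (cl w), Ordinal wlt).
  by rewrite /psi /= enum_rankK_in // nth_index // mem_enum.
exists #|P|; split; first by rewrite -(bij_eq_card bij) card_prod !card_ord.
apply: isomorphic_sym; exists psi => // x y; rewrite -[LHS]negbK -clE !psiE.
by rewrite (inj_eq enum_val_inj).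
Qed.

End Multipartite.

(** * The trees T(p, q) *)

Section Broom.
Variable T : sgraph.
Implicit Types (a b x y z : T).

(* The trees T(p, q), with y, a, b in the roles of v_2, v_3, v_4. *)
Definition broom y a b := [/\ edge y a, edge a b, y != b, ~~ edge y b &
  forall x, [\/ x \in [:: y; a; b], leaf_at x y | leaf_at x b]].

Lemma broom_sym y a b : broom y a b -> broom b a y.
Proof.
case=> ya ab yb nyb all; split; rewrite 1?edge_sym 1?eq_sym // => x.
case: (all x) => lx; [apply: Or31 | exact: Or33 | exact: Or32].
by move: lx; rewrite !inE => /or3P[] ->; rewrite ?orbT.
Qed.

Lemma leaf_edge x y z : leaf_at x y -> edge x z = (z == y).
Proof.
by case=> yx one; apply/idP/eqP=> [/one|->].
Qed.

(** Every neighbour of y other than a is a leaf at y, because neither b nor a leaf at b is adjacent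
    to y; the same holds with y and b exchanged. Counting these leaves gives p and q. *)
Lemma broom_isomorphic y a b : broom y a b ->
  isomorphic T (treeT #|nb y :\ a| #|nb b :\ a|).
Proof.
move=> Y; have [ya ab yb nyb all] := Y; apply: isomorphic_sym.
have ay : edge a y by rewrite edge_sym.
have ba : edge b a by rewrite edge_sym.
have nby : ~~ edge b y by rewrite edge_sym.
have by' : b != y by rewrite eq_sym.
have leaf_y x : x \in nb y :\ a -> leaf_at x y.
  rewrite !inE => /andP[xa yx]; case: (all x) => // [|[bx one]].
    rewrite !inE (negbTE xa) orFb => /orP[] /eqP xE; move: yx; rewrite xE ?edge_irrefl //.
    by rewrite (negbTE nyb).
  by case/eqP: yb; apply: one; rewrite edge_sym.
have leaf_b x : x \in nb b :\ a -> leaf_at x b.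
  rewrite !inE => /andP[xa bx]; case: (all x) => // [|[yx one]].
    rewrite !inE (negbTE xa) orFb => /orP[] /eqP xE; move: bx; rewrite xE ?edge_irrefl //.
    by rewrite (negbTE nby).
  by case/eqP: by'; apply: one; rewrite edge_sym.
pose psi (i : 'I_3 + ('I_#|nb y :\ a| + 'I_#|nb b :\ a|)) : T := match i with
  | inl j => nth b [:: y; a; b] j
  | inr (inl j) => enum_val j
  | inr (inr j) => enum_val j end.
have L1 j : leaf_at (psi (inr (inl j))) y by apply/leaf_y/enum_valP.
have L2 j : leaf_at (psi (inr (inr j))) b by apply/leaf_b/enum_valP.
have leaf_a x z : leaf_at x z -> (z == y) || (z == b) -> x != a.
  move=> lx zE; apply: contraNneq yb => xa; rewrite xa in lx.
  move: ay ab; rewrite !(leaf_edge _ lx); case/orP: zE => /eqP->.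
    by rewrite eq_sym.
  by [].
have ya' : y != a by rewrite edge_neq.
have ba' : b != a by rewrite edge_neq.
have uniq3 : uniq [:: y; a; b] by rewrite /= !inE negb_or ya' yb eq_sym ba'.
have mem3 j : psi (inl j) \in [:: y; a; b] by apply: mem_nth.
have core x z : leaf_at x z -> (z == y) || (z == b) -> x \notin [:: y; a; b].
  move=> lx zE; have xa := leaf_a x z lx zE.
  rewrite !inE (negbTE xa) /=; apply/negP=> /orP[] /eqP xE; rewrite xE in lx.
    by move: ya; rewrite (leaf_edge _ lx); case/orP: zE => /eqP->; rewrite eq_sym ?(negbTE ya') ?(negbTE ba').
  by move: ba; rewrite (leaf_edge _ lx); case/orP: zE => /eqP->; rewrite eq_sym ?(negbTE ya') ?(negbTE ba').
have N1 j : psi (inr (inl j)) \notin [:: y; a; b] by apply: core (L1 j) _; rewrite eqxx.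
have N2 j : psi (inr (inr j)) \notin [:: y; a; b] by apply: core (L2 j) _; rewrite eqxx orbT.
have N12 i j : psi (inr (inl i)) <> psi (inr (inr j)).
  move=> eij; have := L2 j; rewrite -eij => lb.
  by move: (leaf_edge y lb); rewrite (leaf_edge y (L1 i)) eqxx (negbTE yb).
exists psi.
  apply: inj_surj_bij => [[i|[i|i]] [j|[j|j]] eij|x].
  - by congr inl; apply/val_inj/eqP; rewrite -(nth_uniq b _ _ uniq3) ?ltn_ord //; apply/eqP.
  - by have := N1 j; rewrite -eij mem3.
  - by have := N2 j; rewrite -eij mem3.
  - by have := N1 i; rewrite eij mem3.
  - by rewrite (enum_val_inj eij).
  - by case: (N12 i j).
  - by have := N2 i; rewrite eij mem3.
  - by case: (N12 j i).
  - by rewrite (enum_val_inj eij).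
  case: (all x) => [x3|lx|lx].
  - have lt : index x [:: y; a; b] < 3 by rewrite -[3]/(size [:: y; a; b]) index_mem.
    by exists (inl (Ordinal lt)); rewrite /psi /= -[LHS]/(nth b [:: y; a; b] (index x [:: y; a; b])) nth_index.
  - have xL : x \in nb y :\ a by rewrite !inE (leaf_a x y) ?eqxx // edge_sym; case: lx.
    by exists (inr (inl (enum_rank_in xL x))); rewrite /psi enum_rankK_in.
  - have xL : x \in nb b :\ a by rewrite !inE (leaf_a x b) ?eqxx ?orbT // edge_sym; case: lx.
    by exists (inr (inr (enum_rank_in xL x))); rewrite /psi enum_rankK_in.
(* All adjacencies and inequalities among y, a, b, collected as rewrite rules that settle the cases
   on ordinals below 3. *)
pose facts := (edge_irrefl, ya, ay, ab, ba, negbTE nyb, negbTE nby, negbTE yb, negbTE by',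
  negbTE ya', negbTE ba', eq_sym a y, eq_sym a b, eqxx).
have E1 i j : edge (psi (inl i)) (psi (inr (inl j))) = (i == 0 :> nat).
  by rewrite edge_sym (leaf_edge _ (L1 j)); case: i => [[|[|[|]]]] //= _; rewrite !facts.
have E2 i j : edge (psi (inl i)) (psi (inr (inr j))) = (i == 2 :> nat).
  by rewrite edge_sym (leaf_edge _ (L2 j)); case: i => [[|[|[|]]]] //= _; rewrite !facts.
have leaf3 x z : x \notin [:: y; a; b] -> z \in [:: y; b] -> (x == z) = false.
  by move=> x3 zE; apply: contraNF x3 => /eqP->; move: zE; rewrite !inE => /orP[] ->; rewrite ?orbT.
move=> [i|[i|i]] [j|[j|j]]; rewrite -[RHS]/(treeT_edge _ _) /treeT_edge /treeT_arc ?orbF ?orFb.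
- by case: i j => [[|[|[|]]]] // ? [[|[|[|]]]] // ?; rewrite /= !facts.
- exact: E1.
- exact: E2.
- by rewrite edge_sym E1.
- by rewrite (leaf_edge _ (L1 i)) leaf3 // inE eqxx.
- by rewrite (leaf_edge _ (L1 i)) leaf3 // inE eqxx.
- by rewrite edge_sym E2.
- by rewrite (leaf_edge _ (L2 i)) leaf3 // !inE eqxx orbT.
- by rewrite (leaf_edge _ (L2 i)) leaf3 // !inE eqxx orbT.
Qed.

End Broom.

(** * Partial embeddings: adding and moving one vertex *)

Section PartialEmbedding.
Variables T G : sgraph.
Implicit Types (f : T -> G) (Q : {set T}).

Definition partial_embedding Q f :=
  {in Q &, injective f} /\ {in Q &, forall a b, edge a b -> edge (f a) (f b)}.

Lemma partial_embeddingS Q Q' f :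
  Q' \subset Q -> partial_embedding Q f -> partial_embedding Q' f.
Proof. by move=> /subsetP sub [inj hom]; split=> a b /sub aQ /sub bQ; [apply: inj | apply: hom]. Qed.

Lemma partial_embedding_add Q f q g : partial_embedding Q f -> q \notin Q ->
  (forall c, c \in Q -> f c != g) -> (forall c, c \in Q -> edge q c -> edge (f c) g) ->
  exists f', [/\ partial_embedding (q |: Q) f', f' q = g & forall c, c \in Q -> f' c = f c].
Proof.
move=> [inj hom] qQ new adj; exists (fun x => if x == q then g else f x).
have neq c : c \in Q -> (c == q) = false by move=> cQ; apply: contraNF qQ => /eqP<-.
split=> [||c cQ]; rewrite ?eqxx ?neq //; split=> a b /setU1P[->|aQ] /setU1P[->|bQ].
- by [].
- by rewrite eqxx neq // => /esym/eqP; rewrite (negbTE (new b bQ)).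
- by rewrite eqxx neq // => /eqP; rewrite (negbTE (new a aQ)).
- by rewrite !neq //; apply: inj.
- by rewrite edge_irrefl.
- by rewrite eqxx neq // => qb; rewrite edge_sym; apply: adj.
- by rewrite eqxx neq // edge_sym; apply: adj.
- by rewrite !neq //; apply: hom.
Qed.

Lemma partial_embedding_move Q f q g : partial_embedding Q f -> q \in Q ->
  (forall c, c \in Q -> f c != g) -> (forall c, c \in Q -> edge q c -> edge (f c) g) ->
  exists f', [/\ partial_embedding Q f', f' q = g & forall c, c \in Q -> c != q -> f' c = f c].
Proof.
move=> pf qQ new adj.
have [||c|f' [pf' fq ff']] :=
  partial_embedding_add (partial_embeddingS (subD1set Q q) pf) (q := q) (g := g).
- by rewrite !inE eqxx.
- by move=> c /setD1P[_]; apply: new.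
- by case/setD1P=> _; apply: adj.
exists f'; split=> // [|c cQ cq]; first by rewrite -(setD1K qQ).
by apply: ff'; rewrite !inE cq.
Qed.

Lemma partial_embeddingT f : partial_embedding setT f -> embeds T G.
Proof.
by move=> [inj hom]; exists f => [a b|a b]; [apply: inj | apply: hom].
Qed.

End PartialEmbedding.

(** * Embedding T into G, starting around a hub *)

Section Main.
Variables (T G : sgraph) (d : nat).
Hypotheses (tree : is_tree T) (conn : connected_graph G).
Hypotheses (deg_ge : forall v : G, d <= #|nb v|) (cardG : d + 3 <= #|G|).
Hypotheses (cardT : #|T| = d + 3) (deg_le : forall x : T, #|nb x| <= d).
Implicit Types (f : T -> G) (a b c e h p q x y z : T) (D Q S : {set T}) (g s t u v w : G).

(** The next vertex q has a single placed neighbour p. At most d vertices are placed, one of them p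
    itself, so at most d - 1 of the at least d neighbours of [f p] are used and one is free for
    q. *)
Lemma greedy_extension r Q D f :
  subtree r Q -> partial_embedding Q f -> (forall c, c \in Q -> c \notin D) ->
  (forall e x, e \in D -> edge e x -> x \in D :|: Q) -> #|~: D| <= d + 1 ->
  exists2 f', partial_embedding (~: D) f' & forall c, c \in Q -> f' c = f c.
Proof.
move=> + + + + cD; have [n] := ubnP #|~: (D :|: Q)|.
elim: n Q f => // n IHn Q f small stQ pQ QD clD.
have QsD : Q \subset ~: D by apply/subsetP=> c cQ; rewrite inE QD.
have [DQ|[p [q [pQ' qQ qD pq]]]] := subtree_grow tree stQ clD.
  exists f => //; apply: partial_embeddingS pQ; apply/subsetP=> c; rewrite inE => cD'.
  by have := in_setT c; rewrite -DQ inE (negbTE cD').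
have cardQ : #|Q| <= d.
  have : #|q |: Q| <= d + 1.
    apply: leq_trans cD; apply/subset_leq_card/subsetP=> c /setU1P[->|/QD]; by rewrite inE.
  by rewrite cardsU1 qQ addn1.
have [g] : exists g, g \in nb (f p) :\: f @: Q.
  apply/card_gt0P; rewrite cardsD subn_gt0.
  apply: leq_ltn_trans (_ : #|f @: Q :\ f p| < _).
    apply/subset_leq_card/subsetP=> g; rewrite !inE => /andP[pg ->]; rewrite andbT.
    by rewrite eq_sym edge_neq.
  have := leq_imset_card f Q; rewrite (cardsD1 (f p)) imset_f //= add1n => lt1.
  exact: leq_trans lt1 (leq_trans cardQ (deg_ge _)).
rewrite !inE => /andP[gQ pg].
have [|c cQ qc|f' [pf' fq ff']] := partial_embedding_add pQ qQ (g := g).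
- by move=> c cQ; apply: contraNneq gQ => <-; apply: imset_f.
- by rewrite (subtree_nb_uniq tree stQ qQ cQ pQ' qc) // edge_sym.
have [|||||f'' pf'' ff''] := IHn (q |: Q) f'.
- move: small; rewrite ltnS; apply: leq_trans; rewrite [X in _ < X](cardsD1 q) !inE negb_or qD qQ ltnS.
  by apply/subset_leq_card/subsetP=> c; rewrite !inE !negb_or => /and3P[-> -> ->].
- exact: subtreeU pq.
- exact: pf'.
- by move=> c /setU1P[->|/QD].
- move=> e x eD ex; have := clD e x eD ex; rewrite !inE.
  by case/orP=> -> //; rewrite !orbT.
- by exists f'' => // c cQ; rewrite ff'' ?ff' // inE cQ orbT.
Qed.

Definition hub h D := [/\ h \notin D, #|D| = 2 &
  forall e x, e \in D -> edge e x -> x \in h |: D].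

(** The common target of the arguments around a hub; [good_two_leaves] and [good_pendant_path] turn
    it into an embedding of T. *)
Definition good h D := exists2 f : T -> G, partial_embedding (~: D) f &
  2 <= #|nb (f h) :\: f @: (~: D)|.

(* S has d + 1 vertices in the applications, so each non-neighbour of f h in the
   image leaves one more neighbour of f h outside it. *)
Lemma card_outside f Q S h : h \in Q -> Q \subset S -> #|S| <= d + 1 ->
  #|nb (f h)| + #|f @: Q :\: (f h |: nb (f h))| <= d + #|nb (f h) :\: f @: S|.
Proof.
move=> hQ QS cS; set v := f h.
have vS : v \in f @: S by apply: imset_f; apply: (subsetP QS).
have := leq_trans (leq_imset_card f S) cS; rewrite (cardsD1 v) vS.
rewrite -(cardsID (nb v) (f @: S :\ v)) -(cardsID (f @: S) (nb v)).
have -> : (f @: S :\ v) :&: nb v = nb v :&: f @: S.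
  by apply/setP=> g; rewrite !inE; case: eqP => [->|_]; rewrite ?edge_irrefl //= andbC.
have : #|f @: Q :\: (v |: nb v)| <= #|(f @: S :\ v) :\: nb v|.
  apply/subset_leq_card/subsetP=> g; rewrite !inE negb_or => /andP[/andP[-> ->]].
  exact: (subsetP (imsetS f QS)).
by clear; lia.
Qed.

(* D is the pair of vertices placed last; this needs two free neighbours of the
   image of h. *)
Section Hub.
Variables (h : T) (D : {set T}).
Hypothesis hubD : hub h D.

Lemma card_hubC : #|~: D| = d + 1.
Proof.
case: hubD => _ D2 _; have := cardsC D; rewrite D2 cardT; clear; lia.
Qed.

(** A prescribed start of the embedding around h, from which [greedy_extension] takes over. *)
Definition prefix Q f :=
  [/\ subtree h Q, partial_embedding Q f & forall c, c \in Q -> c \notin D].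

(** The greedy extension keeps the images of Q, and [card_outside], with the complement of D as S,
    converts excess degree and prescribed non-neighbours of [f h] into two free neighbours. *)
Lemma prefix_good Q f : prefix Q f ->
  d + 2 <= #|nb (f h)| + #|f @: Q :\: (f h |: nb (f h))| -> good h D.
Proof.
move=> [stQ pQ QD] big; case: hubD => hD D2 clD.
have hQ := subtree_root stQ.
have [e x eD ex||f' pf' ff'] := greedy_extension stQ pQ QD.
- by have := clD e x eD ex; rewrite !inE => /orP[/eqP->|->]; rewrite ?hQ ?orbT.
- by rewrite card_hubC.
exists f' => //.
have QsD : Q \subset ~: D by apply/subsetP=> c cQ; rewrite inE QD.
have := @card_outside f' Q (~: D) h hQ QsD; rewrite card_hubC.
have -> : f' @: Q = f @: Q by apply: eq_in_imset.
by rewrite ff' //; move: big; clear => big /(_ (leqnn _)); lia.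
Qed.

Lemma prefix1 v : prefix [set h] (fun=> v).
Proof.
case: hubD => hD _ _; split; first exact: subtree1.
  by split=> a b /set1P-> /set1P->; rewrite ?edge_irrefl.
by move=> c /set1P->.
Qed.

Lemma prefix_add Q f p q g : prefix Q f -> p \in Q -> q \notin Q -> q \notin D ->
  edge p q -> edge (f p) g -> (forall c, c \in Q -> f c != g) ->
  exists f', [/\ prefix (q |: Q) f', f' q = g & forall c, c \in Q -> f' c = f c].
Proof.
move=> [stQ pQ QD] pQ' qQ qD pq pg new.
have [|c cQ qc|f' [pf' fq ff']] := partial_embedding_add pQ qQ (g := g); first exact: new.
  by rewrite (subtree_nb_uniq tree stQ qQ cQ pQ' qc) // edge_sym.
exists f'; split=> //; split=> //; first exact: subtreeU pq.
by move=> c /setU1P[->|/QD].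
Qed.

Lemma prefix_good2 Q f b c : prefix Q f -> b \in Q -> c \in Q -> f b != f c ->
  f b != f h -> ~~ edge (f h) (f b) -> f c != f h -> ~~ edge (f h) (f c) -> good h D.
Proof.
move=> pQ bQ cQ bc bh nhb ch nhc; apply: (prefix_good pQ).
apply: leq_add (deg_ge _) _; apply: leq_trans (_ : #|[set f b; f c]| <= _).
  by rewrite cards2 bc.
by apply/subset_leq_card/subsetP=> g /set2P[]->; rewrite !inE negb_or ?bh ?ch ?nhb ?nhc imset_f.
Qed.

Lemma prefix3 a b v s w : edge h a -> edge a b -> b != h -> a \notin D -> b \notin D ->
  edge v s -> edge s w -> w != v ->
  exists f, [/\ prefix (b |: (a |: [set h])) f, f h = v, f a = s & f b = w].
Proof.
move=> ha ab bh aD bD vs sw wv; have p1 := prefix1 v.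
have [||c|f1 [p2 fa eq1]] := @prefix_add _ _ h a s p1 (set11 h) _ aD ha.
- by rewrite inE eq_sym edge_neq.
- exact: vs.
- by move=> _; rewrite edge_neq.
have fh : f1 h = v by rewrite eq1 // set11.
have [|||c|f2 [p3 fb eq2]] := @prefix_add _ _ a b w p2 _ _ bD ab.
- exact: setU11.
- by rewrite !inE negb_or bh eq_sym edge_neq.
- by rewrite fa.
- by case/setU1P=> [->|/set1P->]; rewrite ?fa ?fh 1?eq_sym // eq_sym edge_neq.
by exists f2; split=> //; rewrite eq2 // !inE eqxx ?orbT.
Qed.

(** With h sent to v, degree d + 2 suffices by itself. Degree d + 1 needs one non-neighbour of v in
    the image: b is sent to the end of an induced path of length 2 from v. *)
Lemma good_deg a b v : edge h a -> edge a b -> b != h -> a \notin D -> b \notin D ->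
  d < #|nb v| -> good h D.
Proof.
move=> ha ab bh aD bD big; have [big2|small2] := ltnP d.+1 #|nb v|.
  by apply: (prefix_good (prefix1 v)); apply: leq_trans (leq_addr _ _); rewrite addn2.
have [|s [w [vs sw wv nvw]]] := induced_path2 conn (v := v).
  by move: cardG small2; clear; lia.
have [f [pf fh fa fb]] := prefix3 ha ab bh aD bD vs sw wv.
apply: (prefix_good pf); rewrite fh.
have : 0 < #|f @: (b |: (a |: [set h])) :\: (v |: nb v)|.
  by apply/card_gt0P; exists w; rewrite !inE negb_or wv nvw -fb imset_f // setU11.
move: big; clear; lia.
Qed.

(** Call a vertex far if it is neither v nor adjacent to v. The set X consists of the far vertices
    with a far neighbour. An edge from x in X to s outside X has s adjacent to v, so h, a, b, c can
    go to v, s, x, y with y a far neighbour of x. *)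
Lemma good_path a b c v w w' : edge h a -> edge a b -> edge b c ->
  b != h -> c != h -> c != a -> a \notin D -> b \notin D -> c \notin D ->
  w != v -> ~~ edge v w -> ~~ edge v w' -> edge w w' -> good h D.
Proof.
move=> ha ab bc bh ch ca aD bD cD wv nvw nvw' ww'.
pose X : {set G} := [set x | [&& x != v, ~~ edge v x & [exists y, [&& edge x y, y != v & ~~ edge v y]]]].
have w'v : w' != v by apply: contraNneq nvw => <-; rewrite edge_sym.
have wX : w \in X by rewrite inE wv nvw; apply/existsP; exists w'; rewrite ww' w'v.
have vX : v \notin X by rewrite inE eqxx.
have [x [s [xX sX xs]]] := edge_leaving conn wX vX.
move: xX; rewrite inE => /and3P[xv nvx /existsP[y /and3P[xy yv nvy]]].
have vs : edge v s.
  apply/negPn/negP=> nvs; move: sX; rewrite inE nvs; case: eqVneq => [sv|sv] /=.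
    by rewrite -sv edge_sym xs in nvx.
  by case/existsP; exists x; rewrite edge_sym xs xv.
have sx : edge s x by rewrite edge_sym.
have [f [pf fh fa fb]] := prefix3 ha ab bh aD bD vs sx xv.
have [|||e|f' [pf' fc ff']] := @prefix_add _ _ b c y pf _ _ cD bc.
- exact: setU11.
- by rewrite !inE !negb_or ch ca eq_sym edge_neq.
- by rewrite fb.
- case/setU1P=> [->|/setU1P[->|/set1P->]]; first by rewrite fb edge_neq.
    by rewrite fa; apply: contraNneq nvy => <-.
  by rewrite fh eq_sym.
apply: (prefix_good2 (b := b) (c := c) pf').
- by rewrite !inE eqxx !orbT.
- exact: setU11.
- by rewrite fc ff' ?fb ?edge_neq // setU11.
- by rewrite !ff' ?fb ?fh // !inE eqxx ?orbT.
- by rewrite !ff' ?fb ?fh // !inE eqxx ?orbT.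
- by rewrite fc !ff' ?fh // !inE eqxx ?orbT.
- by rewrite fc !ff' ?fh // !inE eqxx ?orbT.
Qed.

(** The adjacency conditions on g and g' quantify over f because p and p' may be any vertices
    already placed; this covers long paths, two branches and forks alike. *)
Lemma prefix5 a b p q p' q' v s w g g' : edge h a -> edge a b -> b != h ->
  p \in b |: (a |: [set h]) -> q \notin b |: (a |: [set h]) -> edge p q ->
  p' \in q |: (b |: (a |: [set h])) -> q' \notin q |: (b |: (a |: [set h])) -> edge p' q' ->
  a \notin D -> b \notin D -> q \notin D -> q' \notin D ->
  edge v s -> edge s w -> w != v -> g \notin [:: v; s; w] -> g' \notin [:: v; s; w; g] ->
  (forall f, f h = v -> f a = s -> f b = w -> edge (f p) g) ->
  (forall f, f h = v -> f a = s -> f b = w -> f q = g -> edge (f p') g') ->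
  exists f, [/\ prefix (q' |: (q |: (b |: (a |: [set h])))) f,
    f h = v /\ f a = s, f b = w, f q = g & f q' = g'].
Proof.
move=> ha ab bh pQ qQ pq pQ' qQ' pq' aD bD qD qD' vs sw wv gN gN' adj adj'.
have [f [pf fh fa fb]] := prefix3 ha ab bh aD bD vs sw wv.
move: gN gN'; rewrite !inE !negb_or => /and3P[gv gs gw] /and4P[gv' gs' gw' gg'].
have [|c|f1 [p1 fq ff1]] := prefix_add pf pQ qQ qD pq (g := g).
- exact: adj.
- by case/setU1P=> [->|/setU1P[->|/set1P->]]; rewrite ?fa ?fh ?fb eq_sym.
have [fa1 fb1 fh1] : [/\ f1 a = s, f1 b = w & f1 h = v].
  by split; rewrite ff1 // !inE eqxx ?orbT.
have [|c|f2 [p2 fq' ff2]] := prefix_add p1 pQ' qQ' qD' pq' (g := g').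
- exact: adj'.
- by case/setU1P=> [->|/setU1P[->|/setU1P[->|/set1P->]]]; rewrite ?fa1 ?fh1 ?fb1 ?fq eq_sym.
by exists f2; split=> //; try split; rewrite ff2 // !inE eqxx ?orbT.
Qed.

Lemma good_branches a b a' b' : (forall v, #|nb v| = d) ->
  edge h a -> edge a b -> b != h -> a' \notin b |: (a |: [set h]) -> edge h a' ->
  b' \notin a' |: (b |: (a |: [set h])) -> edge a' b' ->
  a \notin D -> b \notin D -> a' \notin D -> b' \notin D -> good h D.
Proof.
move=> reg ha ab bh a'Q ha' b'Q ab' aD bD a'D b'D.
have [s [v [w [t [t' [[sv sw vw nvw] vt wt' tt' [ts nst t's nst']]]]]]] :=
  two_branches conn reg cardG.
have wt : w != t by apply: contraTneq sw => ->.
have t'v : t' != v by apply: contraTneq sv => <-.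
(* The tree path b, a, h, a', b' goes to t, v, s, w, t', so that h sits at s and both ends are
   non-neighbours of s. *)
have [||||f fh fa fb|f fh fa fb fa'|f [pf [fh fa] fb fa' fb']] :=
  @prefix5 a b h a' a' b' s v t w t' ha ab bh _ a'Q ha' _ b'Q ab' aD bD a'D b'D sv vt ts.
- by rewrite !inE eqxx !orbT.
- exact: setU11.
- by rewrite !inE !negb_or wt andbT eq_sym edge_neq // eq_sym.
- by rewrite !inE !negb_or t's t'v eq_sym tt' eq_sym edge_neq.
- by rewrite fh.
- by rewrite fa'.
apply: (prefix_good2 (b := b) (c := b') pf); rewrite ?fb ?fh ?fb' //.
- by rewrite !inE eqxx !orbT.
- exact: setU11.
Qed.

Lemma good_fork a b b' : (forall v, #|nb v| = d) -> 3 <= d ->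
  edge h a -> edge a b -> b != h -> b' \notin b |: (a |: [set h]) -> edge a b' ->
  a \notin D -> b \notin D -> b' \notin D -> good h D.
Proof.
move=> reg d3 ha ab bh b'Q ab' aD bD b'D.
have [v [s [w [w' [vs sw sw' ww' [wv nvw w'v nvw']]]]]] := two_private_nb conn reg cardG d3.
have [f [pf fh fa fb]] := prefix3 ha ab bh aD bD vs sw wv.
have [||c|f' [pf' fb' ff']] := @prefix_add _ _ a b' w' pf _ b'Q b'D ab'.
- by rewrite !inE eqxx !orbT.
- by rewrite fa.
- case/setU1P=> [->|/setU1P[->|/set1P->]]; first by rewrite fb.
    by rewrite fa edge_neq.
  by rewrite fh eq_sym.
have fb2 : f' b = w by rewrite ff' // setU11.
have fh2 : f' h = v by rewrite ff' // !inE eqxx !orbT.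
apply: (prefix_good2 (b := b) (c := b') pf'); rewrite ?fb2 ?fh2 ?fb' //.
- by rewrite !inE eqxx !orbT.
- exact: setU11.
Qed.

(** * The tree seen by depth below the hub *)

Section Depth.
Variable dp : T -> nat.
Hypothesis dpP : depth_function h dp.

Lemma depth_neq x y : dp x != dp y -> x != y.
Proof. by apply: contraNneq => ->. Qed.

Lemma depth0 x : dp x = 0 -> x = h.
Proof.
by case: dpP => _ _ _ par x0; apply: contraTeq isT => /par[y _]; rewrite x0.
Qed.

Lemma depth_child x : edge h x -> dp x = 1.
Proof. by case: dpP => h0 step _ _ /step; rewrite h0; case. Qed.

(** The parent avoids D because the only vertex outside D adjacent to D is h, at depth 0. *)
Lemma depth_parent x k : x \notin D -> dp x = k.+1 ->
  exists y, [/\ y \notin D, edge y x & dp y = k].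
Proof.
case: dpP => h0 _ _ par; case: hubD => _ _ clD xD xk.
have [|y xy] := par x; first by apply: contra_eq_neq xk => ->; rewrite h0.
rewrite xk => -[yk]; exists y; split=> //; last by rewrite edge_sym.
apply/negP=> yD; have := clD y x yD; rewrite edge_sym xy => /(_ isT).
by rewrite !inE (negbTE xD) orbF => /eqP xh; rewrite xh h0 in xk.
Qed.

Lemma depth_ancestor k x : x \notin D -> k <= dp x -> exists2 y, y \notin D & dp y = k.
Proof.
move=> + kx; have [n nE] : exists n, dp x = n + k by exists (dp x - k); rewrite subnK.
elim: n x nE {kx} => [|n IHn] x xn xD; first by exists x.
have [y [yD _ yn]] := depth_parent xD xn.
exact: IHn yD.
Qed.

Lemma depth2_path b : b \notin D -> dp b = 2 ->
  exists a, [/\ a \notin D, edge h a, edge a b & dp a = 1].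
Proof.
move=> bD b2; have [a [aD ab a1]] := depth_parent bD b2.
have [x [_ xa x0]] := depth_parent aD a1.
by exists a; rewrite -(depth0 x0).
Qed.

Lemma depth3_path c : c \notin D -> dp c = 3 ->
  exists a b, [/\ a \notin D /\ b \notin D, edge h a, edge a b, edge b c & dp a = 1 /\ dp b = 2].
Proof.
move=> cD c3; have [b [bD bc b2]] := depth_parent cD c3.
have [a [aD ha ab a1]] := depth2_path bD b2.
by exists a, b.
Qed.

Lemma depth_far x : x != h -> ~~ edge h x -> 1 < dp x.
Proof.
move=> xh nhx; case dx: (dp x) => [|[|k]] //; first by rewrite (depth0 dx) eqxx in xh.
case: dpP => _ _ _ par; have [y xy] := par x xh; rewrite dx => -[/esym y0].
by rewrite edge_sym -(depth0 y0) xy in nhx.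
Qed.

(** If [good] fails, [good_deg] forces regularity, and two vertices at depth 2 are impossible, as
    they form a fork or two branches. Then b1 and b2 cannot both have depth 2, so depth 3 occurs,
    and [good_path] makes non-adjacency transitive. *)
Lemma hub_dichotomy b1 b2 : b1 != b2 -> b1 \notin D -> b2 \notin D -> 1 < dp b1 -> 1 < dp b2 ->
  good h D \/
  [/\ forall v, #|nb v| = d,
      forall v w w', ~~ edge v w -> ~~ edge v w' -> ~~ edge w w',
      forall b b', b \notin D -> b' \notin D -> dp b = 2 -> dp b' = 2 -> b = b' &
      exists2 c, c \notin D & dp c = 3].
Proof.
move=> b12 b1D b2D b1gt b2gt; case: (classic (good h D)) => bad; [by left | right].
have h0 : dp h = 0 by case: dpP.
have reg v : #|nb v| = d.
  apply/eqP; rewrite eqn_leq deg_ge andbT leqNgt; apply/negP=> big; apply: bad.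
  have [b bD b2'] := depth_ancestor b1D b1gt; have [a [aD ha ab a1]] := depth2_path bD b2'.
  by apply: (good_deg ha ab _ aD bD big); rewrite depth_neq // b2' h0.
have uniq2 b b' : b \notin D -> b' \notin D -> dp b = 2 -> dp b' = 2 -> b = b'.
  move=> bD b'D b2' b'2; apply/eqP/negPn/negP=> bb'; apply: bad.
  have [a [aD ha ab a1]] := depth2_path bD b2'.
  have [a' [a'D ha' ab' a'1]] := depth2_path b'D b'2.
  have bh : b != h by rewrite depth_neq // b2' h0.
  have b'h : b' != h by rewrite depth_neq // b'2 h0.
  have b'b : b' != b by rewrite eq_sym.
  have b'a : b' != a by rewrite depth_neq // b'2 a1.
  have a'b : a' != b by rewrite depth_neq // a'1 b2'.
  have [aE|a'a] := eqVneq a' a.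
    rewrite aE in ab'; have b'Q : b' \notin b |: (a |: [set h]).
      by rewrite !inE !negb_or b'b b'a b'h.
    apply: (good_fork reg _ ha ab bh b'Q ab' aD bD b'D).
    (* Four distinct vertices lie in the complement of D, which has d + 1 elements; hence [3 <= d],
       as the fork requires. *)
    have : #|b' |: (b |: (a |: [set h]))| <= #|~: D|.
      apply/subset_leq_card/subsetP=> x; rewrite !inE.
      by case/or4P=> /eqP-> //; case: hubD.
    have ba : b != a by rewrite eq_sym edge_neq.
    have ah : a != h by rewrite eq_sym edge_neq.
    by rewrite card_hubC cardsU1 b'Q !cardsU1 cards1 !inE !negb_or bh ba ah; clear; lia.
  apply: (good_branches reg ha ab bh _ ha' _ ab' aD bD a'D b'D).
  - by rewrite !inE !negb_or a'b a'a eq_sym edge_neq.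
  - by rewrite !inE !negb_or b'b b'a b'h eq_sym edge_neq.
have [c cD c3] : exists2 c, c \notin D & dp c = 3.
  apply: NNPP => none; case/eqP: b12; apply: uniq2 => //; apply/eqP; rewrite eqn_leq ?b1gt ?b2gt andbT leqNgt;
  by apply/negP; move/depth_ancestor => gt; case: none; apply: gt.
split=> // [v w w' vw vw'|]; last by exists c.
apply/negP=> ww'; apply: bad.
have [a [b [[aD bD] ha ab bc [a1 b2']]]] := depth3_path cD c3.
have [wv|wv] := eqVneq w v; first by rewrite -wv ww' in vw'.
by apply: (good_path ha ab bc _ _ _ aD bD cD wv vw vw' ww'); rewrite depth_neq // ?h0 ?a1 ?b2' ?c3.
Qed.

End Depth.

End Hub.

Lemma far_pair y : exists b1 b2,
  [/\ b1 != b2, b1 != y, b2 != y, ~~ edge y b1 & ~~ edge y b2].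
Proof.
have : 1 < #|~: (y |: nb y)|.
  have := cardsC (y |: nb y); move: (card_setU1_le y (nb y)) (deg_le y); rewrite cardT.
  clear; lia.
case/card_gt1P=> b1 [b2 [+ + b12]]; rewrite !inE !negb_or => /andP[b1y yb1] /andP[b2y yb2].
by exists b1, b2.
Qed.

Lemma far_pair_regular v : #|nb v| = d -> exists w w',
  [/\ w != w', w != v, w' != v, ~~ edge v w & ~~ edge v w'].
Proof.
move=> reg; have : 1 < #|~: (v |: nb v)|.
  have := cardsC (v |: nb v); move: (card_setU1_le v (nb v)); rewrite reg.
  move: cardG; clear; lia.
case/card_gt1P=> b1 [b2 [+ + b12]]; rewrite !inE !negb_or => /andP[b1y yb1] /andP[b2y yb2].
by exists b1, b2.
Qed.

(** * Trees with two leaves at one vertex *)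

Section TwoLeaves.
Variables (x1 x2 y : T).
Hypotheses (leaf1 : leaf_at x1 y) (leaf2 : leaf_at x2 y) (x12 : x1 != x2).

Let D := [set x1; x2].

Lemma hub_two_leaves : hub y D.
Proof.
split; last 2 first.
- by rewrite cards2 x12.
- by move=> e x /set2P[]->; [case: leaf1 | case: leaf2] => _ one /one->; rewrite setU11.
rewrite !inE negb_or eq_sym (edge_neq leaf1.1) eq_sym; exact: edge_neq leaf2.1.
Qed.

Lemma good_two_leaves : good y D -> embeds T G.
Proof.
move=> [f pf /card_gt1P[u1 [u2 [+ + u12]]]]; rewrite !inE => /andP[u1N yu1] /andP[u2N yu2].
have new u c : u \notin f @: (~: D) -> c \in ~: D -> f c != u.
  by move=> uN cD; apply: contraNneq uN => <-; apply: imset_f.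
have [|c|c cD|f1 [p1 fx1 ff1]] := partial_embedding_add pf (q := x1) (g := u1).
- by rewrite !inE eqxx.
- exact: new.
- by case: leaf1 => _ one /one->.
have [|c|c cD|f2 [p2 _ _]] := partial_embedding_add p1 (q := x2) (g := u2).
- by rewrite !inE eqxx !orbT eq_sym (negbTE x12).
- by case/setU1P=> [->|cD]; [rewrite fx1 | rewrite ff1 // new].
- case: leaf2 => _ one /one cy; rewrite cy in cD *; rewrite ff1 //.
  by case/setU1P: cD (leaf1.1) => // ->; rewrite edge_irrefl.
apply: partial_embeddingT (f2) _; apply: partial_embeddingS p2.
by apply/subsetP=> c _; rewrite !inE; case: eqP => //= _; case: eqP.
Qed.

(** If T does not embed, [hub_dichotomy] makes G complete multipartite and leaves one vertex b at
    depth 2. Once depth 4 is excluded, T is a broom on y, a, b. Without triangles G is K_(d,d); a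
    triangle in G forces b to carry a single leaf. *)
Lemma two_leaves_embeds : embeds T G \/
  (isomorphic G (complete_bipartite d d) /\
     exists p : nat, [/\ 1 <= p, 1 <= d - p & isomorphic T (treeT p (d - p))]) \/
  ((exists k a : nat, [/\ 2 <= k, 1 <= a, k * a = d & isomorphic G (balanced_multipartite k.+1 a)]) /\
     isomorphic T (treeT 1 (d - 1))).
Proof.
case: (classic (embeds T G)) => [|notin]; [by left | right].
have bad : ~ good y D by move/good_two_leaves.
have hubD := hub_two_leaves.
have [dp dpP] := depth_exists tree y.
have [dp0 step anc par] := dpP.
have xy1 : edge y x1 by rewrite edge_sym; case: leaf1.
have xy2 : edge y x2 by rewrite edge_sym; case: leaf2.
have depthD x : x \in D -> dp x = 1 by case/set2P=> ->; apply: (depth_child dpP).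
have [reg multi uniq2 [c0 c0D c03]] : [/\ forall v : G, #|nb v| = d,
      forall v w w' : G, ~~ edge v w -> ~~ edge v w' -> ~~ edge w w',
      forall b b', b \notin D -> b' \notin D -> dp b = 2 -> dp b' = 2 -> b = b' &
      exists2 c, c \notin D & dp c = 3].
  have [b1 [b2 [b12 b1y b2y nyb1 nyb2]]] := far_pair y.
  have farD b : ~~ edge y b -> b \notin D by apply: contra => /set2P[]->.
  by case: (hub_dichotomy hubD dpP b12) => //; [apply: farD | apply: farD |
    apply: (depth_far dpP) | apply: (depth_far dpP)].
have [a [b [[aD bD] ya ab bc0 [da db]]]] := depth3_path hubD dpP c0D c03.
have d2 : 1 < d.
  apply: leq_trans (deg_le y); apply/card_gt1P; exists x1, x2.
  by rewrite !inE xy1 xy2 x12.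
have farD x : dp x != 1 -> x \notin D by apply: contra => /depthD->.
have neq x z : dp x != dp z -> x != z by apply: contraNneq => ->.
have child3 c : edge b c -> c != a -> dp c = 3.
  move=> bc ca; case: (step _ _ bc); rewrite db; last by [].
  by case=> /esym cE; case/eqP: ca; apply: (anc b); rewrite ?db ?da ?cE // edge_sym.
(* A path y, a', b', c, e could go to v, s, w, s', w' with s, s' neighbours of v and w, w'
   non-neighbours; every neighbour of v is adjacent to every non-neighbour. *)
have no4 e : dp e <> 4.
  move=> e4; apply: bad; have eD : e \notin D by rewrite farD // e4.
  have [c [cD ce c3]] := depth_parent hubD dpP eD e4.
  have [a' [b' [[a'D b'D] ya' ab' bc' [da' db']]]] := depth3_path hubD dpP cD c3.
  have /card_gt0P[v _] : 0 < #|G| by move: cardG d2; clear; lia.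
  have [w [w' [ww' wv w'v nvw nvw']]] := far_pair_regular (reg v).
  have : 1 < #|nb v| by rewrite reg.
  case/card_gt1P=> s [s' [+ + ss']]; rewrite !in_nb => vs vs'.
  have sw : edge s w := multi_edge_nb multi vs nvw.
  have s'w : edge s' w := multi_edge_nb multi vs' nvw.
  have s'w' : edge s' w' := multi_edge_nb multi vs' nvw'.
  have sw' : edge s w' := multi_edge_nb multi vs nvw'.
  have [|||||||f|f|f [pf [fh fa] fb fc fe]] := @prefix5 y D hubD a' b' b' c c e v s w s' w' ya' ab' _ _ _ bc' _ _ ce a'D b'D cD eD vs sw wv.
  - by rewrite neq // db' dp0.
  - exact: setU11.
  - by rewrite !inE !negb_or !neq // ?db' ?dp0 ?c3 ?da'.
  - exact: setU11.
  - by rewrite !inE !negb_or !neq // ?db' ?dp0 ?c3 ?da' ?e4.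
  - by rewrite !inE !negb_or eq_sym (edge_neq vs') eq_sym ss' edge_neq.
  - by rewrite !inE !negb_or w'v eq_sym (edge_neq sw') eq_sym ww' eq_sym edge_neq.
  - by move=> _ _ ->; rewrite edge_sym.
  - by move=> _ _ _ ->.
  apply: (prefix_good2 hubD (b := b') (c := e) pf); rewrite ?fb ?fh ?fe //.
  - by rewrite !inE eqxx !orbT.
  - exact: setU11.
have Br : broom y a b.
  split=> //.
  - by rewrite neq // dp0 db.
  - by apply/negP=> /(depth_child dpP); rewrite db.
  move=> x; case: (boolP (x \in D)) => [/set2P[]->|xD]; [exact: Or32 | exact: Or32 |].
  (* Depth 0 is y, depth 1 consists of a and leaves at y, depth 2 is b, and depth 3 consists of
     leaves at b. *)
  case dx: (dp x) => [|[|[|[|k]]]].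
  - by apply: Or31; rewrite (depth0 dpP dx) !inE eqxx.
  - have [xa|xa] := eqVneq x a; first by apply: Or31; rewrite xa !inE eqxx orbT.
    apply: Or32; have [z [_ zx /(depth0 dpP) zy]] := depth_parent hubD dpP xD dx.
    rewrite zy in zx; split=> [|g xg]; first by rewrite edge_sym.
    case: (step _ _ xg); rewrite dx; first by case=> /esym /(depth0 dpP).
    move=> dg; have gb : g = b by apply: uniq2 => //; rewrite farD // dg.
    case/eqP: xa; apply: (anc b); rewrite ?dx ?da ?db // edge_sym // -gb //.
  - by apply: Or31; rewrite (uniq2 x b) // !inE eqxx !orbT.
  - apply: Or33; have [z [zD zx dz]] := depth_parent hubD dpP xD dx.
    rewrite (uniq2 z b) // in zx; split=> [|g xg]; first by rewrite edge_sym.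
    case: (step _ _ xg); rewrite dx; last by move/no4.
    by case=> dg; apply: uniq2; rewrite // farD // -dg.
  - by have [|e _ /no4[]] := @depth_ancestor y D hubD dp dpP 4 x xD; rewrite dx.
have isoT := broom_isomorphic Br; have isoT' := broom_isomorphic (broom_sym Br).
have cardE : #|nb y :\ a| + #|nb b :\ a| = d.
  have [phi bphi _] := isoT; have := bij_eq_card bphi.
  by rewrite cardT !card_sum !card_ord; clear; lia.
have leaves_y : 1 < #|nb y :\ a|.
  apply/card_gt1P; exists x1, x2; rewrite !inE xy1 xy2; split=> //.
    by rewrite andbT; apply: contraNneq aD => <-; rewrite !inE eqxx.
  by rewrite andbT; apply: contraNneq aD => <-; rewrite !inE eqxx orbT.
have leaves_b : 0 < #|nb b :\ a|.
  by apply/card_gt0P; exists c0; rewrite !inE bc0 neq // c03 da.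
case: (classic (exists v s s' : G, [/\ edge v s, edge v s' & edge s s'])) => [[v [s [s' [vs vs' ss']]]]|free].
  right; split.
    have [r [rE isoG]] : exists r, r * (#|G| - d) = #|G| /\
        isomorphic G (balanced_multipartite r (#|G| - d)).
      by apply: multipartite_isomorphic => //; move: cardG; clear; lia.
    have r3 : 2 < r.
      have [phi _ hom] := isoG.
      have uq : uniq [:: (phi v).1; (phi s).1; (phi s').1].
        by move: vs vs' ss'; rewrite -!hom /= /multi_edge !inE negb_or => -> -> ->.
      have := max_card [in [:: (phi v).1; (phi s).1; (phi s').1]].
      by rewrite (card_uniqP uq) card_ord.
    (* Leaving out one class: k is the number of classes minus one, and k classes contain
       [#|G| - (#|G| - d) = d] vertices. *)
    case: r r3 rE isoG => // r r3 rE isoG; exists r, (#|G| - d); split=> //.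
      by move: cardG; clear; lia.
    by move: rE cardG; rewrite mulSn; clear; lia.
  (* With two leaves c, c' at b, the vertices y, a, b could go to the triangle v, s, s' and c, c' to
     two non-neighbours of v. *)
  have q1 : #|nb b :\ a| = 1.
    apply/eqP; rewrite eqn_leq leaves_b andbT leqNgt; apply/negP=> /card_gt1P[c [c' [+ + cc']]].
    rewrite !inE => /andP[ca bc] /andP[c'a bc']; apply: bad.
    have [w [w' [ww' wv w'v nvw nvw']]] := far_pair_regular (reg v).
    have sw : edge s w := multi_edge_nb multi vs nvw.
    have s'w : edge s' w := multi_edge_nb multi vs' nvw.
    have s'w' : edge s' w' := multi_edge_nb multi vs' nvw'.
    have sw' : edge s w' := multi_edge_nb multi vs nvw'.
    have c3 := child3 c bc ca; have c'3 := child3 c' bc' c'a.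
    have [||||||||||f|f|f [pf [fh fa] fb fc fe]] := @prefix5 y D hubD a b b c b c' v s s' w w' ya ab _ _ _ bc _ _ bc' aD bD _ _ vs ss'.
    - by rewrite neq // db dp0.
    - exact: setU11.
    - by rewrite !inE !negb_or !neq // ?db ?dp0 ?c3 ?da.
    - by rewrite !inE eqxx !orbT.
    - by rewrite !inE !negb_or eq_sym cc' !neq // ?db ?dp0 ?c'3 ?da.
    - by rewrite farD // c3.
    - by rewrite farD // c'3.
    - by rewrite eq_sym edge_neq.
    - by rewrite !inE !negb_or wv eq_sym (edge_neq sw) eq_sym edge_neq.
    - by rewrite !inE !negb_or w'v eq_sym (edge_neq sw') eq_sym (edge_neq s'w') eq_sym.
    - by move=> _ _ ->.
    - by move=> _ _ ->.
    apply: (prefix_good2 hubD (b := c) (c := c') pf); rewrite ?fc ?fh ?fe //.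
    - by rewrite !inE eqxx !orbT.
    - exact: setU11.
  by rewrite q1 in isoT' cardE; rewrite -cardE addnK.
left; split.
  have /card_gt0P[v _] : 0 < #|G| by move: cardG d2; clear; lia.
  have /card_gt0P[s] : 0 < #|nb v| by rewrite reg; apply: leq_trans d2.
  rewrite in_nb => vs; apply: (triangle_free_isomorphic reg multi vs) => w vw.
  by apply/negP=> sw; case: free; exists v, s, w.
exists #|nb y :\ a|; split; first exact: leq_trans leaves_y.
  by rewrite -cardE addKn.
by have -> : d - #|nb y :\ a| = #|nb b :\ a| by rewrite -cardE addKn.
Qed.

End TwoLeaves.

(** * Trees with a pendant path of length two *)

Section PendantPath.
Variables (x y z : T).
Hypotheses (leafx : leaf_at x y) (yz : edge y z) (zx : z != x).
Hypothesis nby : forall c, edge y c -> c = x \/ c = z.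

Let D := [set x; y].

Lemma hub_pendant_path : hub z D.
Proof.
have xy := edge_neq leafx.1.
split.
- by rewrite !inE negb_or zx eq_sym edge_neq.
- by rewrite cards2 xy.
- move=> e c /set2P[]->; first by case: leafx => _ one /one->; rewrite !inE eqxx !orbT.
  by case/nby=> ->; rewrite !inE eqxx ?orbT.
Qed.

Lemma attach_pendant_path f g g' : partial_embedding (~: D) f ->
  edge (f z) g -> edge g g' -> (forall c, c \in ~: D -> f c != g) ->
  (forall c, c \in ~: D -> f c != g') -> embeds T G.
Proof.
move=> pf zg gg' new new'; have [zD _ _] := hub_pendant_path.
have xy := edge_neq leafx.1.
have [||c cD|f1 [p1 f1y ff1]] := partial_embedding_add pf (q := y) (g := g).
- by rewrite !inE eqxx orbT.
- exact: new.
- by case/nby=> cE; rewrite cE ?zg // in cD *; rewrite !inE eqxx in cD.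
have [|c|c cD|f2 [p2 _ _]] := partial_embedding_add p1 (q := x) (g := g').
- by rewrite !inE eqxx orbF (negbTE xy).
- by case/setU1P=> [->|cD]; [rewrite f1y edge_neq | rewrite ff1 // new'].
- by case: leafx => _ one /one->; rewrite f1y.
apply: partial_embeddingT (f2) _; apply: partial_embeddingS p2.
by apply/subsetP=> c _; rewrite !inE; case: (c == x); case: (c == y).
Qed.

Section OtherEnd.
Variables (x' y' : T).
Hypotheses (leafx' : leaf_at x' y') (x'D : x' \notin D) (y'D : y' \notin D).
Hypotheses (y'z : y' != z) (nzx' : ~~ edge z x') (x'z : x' != z).
Hypothesis nby' : edge y' z -> forall c, edge y' c -> c = x' \/ c = z.

(* A free neighbour of f z all of whose neighbours are used misses at most one
   used vertex.  So some used vertex can be rerouted to it, and the vertex of G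
   thus freed serves as the image of x. *)
Lemma good_pendant_path : good z D -> embeds T G.
Proof.
move=> [f pf /card_gt1P[u1 [u2 [+ + u12]]]]; rewrite !inE => /andP[u1N zu1] /andP[u2N zu2].
have [zD _ _] := hub_pendant_path; apply: NNPP => bad.
have inC c : (c \in ~: D) = (c \notin D) by rewrite inE.
have new u c : u \notin f @: (~: D) -> c \notin D -> f c != u.
  by move=> uN cD; apply: contraNneq uN => <-; rewrite imset_f ?inC.
have finj c c' : c \notin D -> c' \notin D -> c != c' -> f c != f c'.
  by move=> cD c'D; apply: contra_neq => /(pf.1 c c'); rewrite !inC; apply.
have miss u e e' : edge (f z) u -> u \notin f @: (~: D) -> e \notin D -> e' \notin D ->
    ~~ edge u (f e) -> ~~ edge u (f e') -> e = e'.
  move=> zu uN eD e'D ne ne'; apply/eqP/negPn/negP=> ee'.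
  have sub : nb u \subset (f @: (~: D)) :\ f e :\ f e'.
    apply/subsetP=> o; rewrite !inE => uo.
    rewrite (contraTneq _ uo) ?(contraTneq _ uo) /=; try by move=> ->.
    apply/negPn/negP=> oN; apply: bad.
    by apply: (attach_pendant_path pf zu uo) => c; rewrite inC; apply: new.
  have := leq_trans (deg_ge u) (subset_leq_card sub).
  have := leq_imset_card f (~: D); rewrite (card_hubC hub_pendant_path).
  rewrite (cardsD1 (f e)) imset_f ?inC // (cardsD1 (f e')) !inE imset_f ?inC // finj // 1?eq_sym //.
  by clear; lia.
(* Otherwise z itself could move to u, with y sent to the freed [f z] and x to u'. *)
have missz u u' : edge (f z) u -> edge (f z) u' -> u \notin f @: (~: D) ->
    u' \notin f @: (~: D) -> u != u' -> exists e, [/\ e \notin D, edge z e & ~~ edge u (f e)].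
  move=> zu zu' uN u'N uu'; apply: NNPP => none; apply: bad.
  have [|c|c|f' [pf' fz ff']] := partial_embedding_move pf (q := z) (g := u); first by rewrite inC.
  - by rewrite inC; apply: new.
  - rewrite inC => cD zc; apply/negPn/negP=> ncu; case: none; exists c.
    by split=> //; rewrite edge_sym.
  have zC : z \in ~: D by rewrite inC.
  apply: (attach_pendant_path pf' (g := f z) (g' := u')) => // [|c|c].
  - by rewrite fz edge_sym.
  - rewrite inC => cD; case: (eqVneq c z) => [->|cz]; first by rewrite fz eq_sym edge_neq.
    by rewrite ff' ?inC // finj.
  - rewrite inC => cD; case: (eqVneq c z) => [->|cz]; first by rewrite fz.
    by rewrite ff' ?inC // new.
have x'C : x' \in ~: D by rewrite inC.
(* Otherwise x' could move to u, with y sent to u' and x to the freed [f x']. *)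
have reroute u u' : edge (f z) u -> edge (f z) u' -> u \notin f @: (~: D) ->
    u' \notin f @: (~: D) -> u != u' -> edge u' (f x') -> ~~ edge u (f y').
  move=> zu zu' uN u'N uu' u'x'; apply/negP=> uy'; apply: bad.
  have [c|c|f' [pf' fx' ff']] := partial_embedding_move pf x'C (g := u).
  - by rewrite inC; apply: new.
  - by case: leafx' => _ one _ /one->; rewrite edge_sym.
  apply: (attach_pendant_path pf' (g := u') (g' := f x')) => // [|c|c].
  - by rewrite ff' ?inC // eq_sym.
  - rewrite inC => cD; case: (eqVneq c x') => [->|cx]; first by rewrite fx'.
    by rewrite ff' ?inC // new.
  - rewrite inC => cD; case: (eqVneq c x') => [->|cx]; first by rewrite fx' eq_sym new.
    by rewrite ff' ?inC // finj.
have u21 : u2 != u1 by rewrite eq_sym.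
have [e1 [e1D ze1 n1]] := missz u1 u2 zu1 zu2 u1N u2N u12.
have [e2 [e2D ze2 n2]] := missz u2 u1 zu2 zu1 u2N u1N u21.
have adjx' u e : edge (f z) u -> u \notin f @: (~: D) -> e \notin D -> edge z e ->
    ~~ edge u (f e) -> edge u (f x').
  move=> zu uN eD ze ne; apply/negPn/negP=> nx'.
  by move: nzx'; rewrite (miss u x' e) ?ze.
have u1x' := adjx' u1 e1 zu1 u1N e1D ze1 n1.
have u2x' := adjx' u2 e2 zu2 u2N e2D ze2 n2.
have u1y' := reroute u1 u2 zu1 zu2 u1N u2N u12 u2x'.
have u2y' := reroute u2 u1 zu2 zu1 u2N u1N u21 u1x'.
(* The one used vertex missed by u1 is thus the image of y', which is adjacent to z and so has
   degree 2. *)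
have y'e1 : y' = e1 by apply: (miss u1).
have zy' : edge z y' by rewrite y'e1.
have nb2 : forall c, edge y' c -> c = x' \/ c = z by apply: nby'; rewrite edge_sym.
have u1adj c : c \notin D -> c != y' -> edge u1 (f c).
  by move=> cD; apply: contraNT => nc; apply/eqP; apply: (miss u1).
apply: bad.
have y'C : y' \in ~: D by rewrite inC.
have zC : z \in ~: D by rewrite inC.
(* The images of x' and y' are exchanged and z moves to u1. The vertex missed by u1 now carries x',
   which is not adjacent to z; y goes to the freed [f z] and x to u2. *)
pose Q := ~: D :\ z :\ y' :\ x'.
have QP c : c \in Q -> [/\ c \notin D, c != z, c != y' & c != x'].
  by rewrite !inE => /and4P[-> -> -> ->].
have x'y' : x' != y' by rewrite edge_neq; case: leafx'.
have pQ : partial_embedding Q f.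
  by apply: partial_embeddingS pf; apply/subsetP=> c /QP[cD _ _ _]; rewrite inC.
have [|c|c|f1 [p1 f1y' ff1]] := partial_embedding_add pQ (q := y') (g := f x').
- by rewrite !inE eqxx !andbF.
- by case/QP=> cD _ _ cx'; apply: finj.
- by case/QP=> _ cz _ cx' /nb2[] cE; move: cz cx'; rewrite cE eqxx.
have [|c|c|f2 [p2 f2x' ff2]] := partial_embedding_add p1 (q := x') (g := f y').
- by rewrite !inE eqxx (negbTE x'y').
- case/setU1P=> [->|cQ]; first by rewrite f1y' finj.
  by rewrite ff1 //; case/QP: cQ => cD _ cy' _; apply: finj.
- case: leafx' => x'y'e one _ /one->; rewrite f1y'.
  by apply: pf.2.
have f2y' : f2 y' = f x' by rewrite ff2 ?setU11.
have f2Q c : c \in Q -> f2 c = f c by move=> cQ; rewrite ff2 ?ff1 // setU1r.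
have [|c|c|f3 [p3 f3z ff3]] := partial_embedding_add p2 (q := z) (g := u1).
- by rewrite !inE !negb_or eq_sym x'z eq_sym y'z eqxx !andbF.
- case/setU1P=> [->|/setU1P[->|cQ]]; first by rewrite f2x' new.
    by rewrite f2y' new.
  by rewrite f2Q // new //; case/QP: cQ.
- case/setU1P=> [->|/setU1P[->|cQ]]; first by rewrite (negbTE nzx').
    by move=> _; rewrite f2y' edge_sym.
  by move=> _; rewrite f2Q // edge_sym; case/QP: cQ => cD _ cy' _; apply: u1adj.
have QE c : c \notin D -> c = z \/ c \in x' |: (y' |: Q).
  move=> cD; have [->|cz] := eqVneq c z; [by left | right].
  by rewrite !inE (negbTE cz) -in_set2 -/D (negbTE cD) /=; case: (c == x'); case: (c == y').
have p4 : partial_embedding (~: D) f3.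
  apply: partial_embeddingS p3; apply/subsetP=> c; rewrite inC => /QE[->|cQ].
    exact: setU11.
  exact: setU1r.
have imf c : c \notin D -> f3 c = u1 \/ exists e, [/\ e \notin D, e != z & f3 c = f e].
  case/QE=> [->|cQ]; [by left | right]; rewrite ff3 //.
  case/setU1P: cQ => [->|/setU1P[->|cQ]].
  - by exists y'.
  - by exists x'.
  - by exists c; rewrite f2Q //; case/QP: cQ.
apply: (attach_pendant_path p4 (g := f z) (g' := u2)) => // [|c|c].
- by rewrite f3z edge_sym.
- rewrite inC => /imf[->|[e [eD ez ->]]]; first by rewrite eq_sym edge_neq.
  exact: finj.
- by rewrite inC => /imf[->|[e [eD ez ->]]] //; apply: new.
Qed.

End OtherEnd.

End PendantPath.

(** A deepest vertex x ends a pendant path x, y, z, with z as hub. If [good] holds, a deepest vertex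
    outside D provides the other leaf used for rerouting; if not, G is d-regular, and the number of
    vertices outside D far from z decides between two constructions. *)
Lemma lone_leaves_embeds :
  (forall x x' y : T, leaf_at x y -> leaf_at x' y -> x = x') -> embeds T G.
Proof.
move=> lone; have /card_gt0P[r _] : 0 < #|T| by rewrite cardT; clear; lia.
have [x [y [z [leafx yz zx nby]]]] : exists x y z,
    [/\ leaf_at x y, edge y z, z != x & forall c, edge y c -> c = x \/ c = z].
  have [dp dpP] := depth_exists tree r.
  have [b [_ [_ br _ nrb _]]] := far_pair r.
  have clD e c : e \in (set0 : {set T}) -> edge e c -> c \in r |: set0 by rewrite inE.
  case: (arg_maxnP dp (erefl : predT b)) => x _ deep.
  have hb : 1 < dp b.
    case: dpP => h0 _ _ par; case db: (dp b) => [|[|k]] //.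
    - by have [c _] := par b br; rewrite db.
    - have [c bc] := par b br; rewrite db => -[/esym c0].
      have [cr|/par[e _]] := eqVneq c r; last by rewrite c0.
      by rewrite edge_sym -cr bc in nrb.
  have [||c _|y [z [lx _ _ yz [zx nby]]]] := deepest_leaf dpP clD lone (x := x).
  - by rewrite inE.
  - exact: leq_trans hb (deep b isT).
  - exact: deep.
  by exists x, y, z.
have hubD := hub_pendant_path leafx yz zx nby.
set D := [set x; y] in hubD.
have [dp dpP] := depth_exists tree z.
have [dp0 step anc par] := dpP; have [zD _ clD] := hubD.
have neq c c' : dp c != dp c' -> c != c' by apply: contraNneq => ->.
have zy : edge z y by rewrite edge_sym.
have [b0 [b0D b0far]] : exists b, b \notin D /\ 1 < dp b.
  have [b1 [b2 [b12 b1z b2z nzb1 nzb2]]] := far_pair z.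
  have farD b : b != x -> ~~ edge z b -> b \notin D.
    by move=> bx nzb; rewrite !inE negb_or bx; apply: contraNneq nzb => ->.
  have [b1x|b1x] := eqVneq b1 x.
    exists b2; split; last exact: (depth_far dpP).
    by rewrite farD // -b1x eq_sym.
  by exists b1; split; [apply: farD | apply: (depth_far dpP)].
have [b bD db] := depth_ancestor hubD dpP b0D b0far.
have [a [aD za ab da]] := depth2_path hubD dpP bD db.
have bz : b != z by rewrite neq // db dp0.
have finish : good z D -> embeds T G.
  case: (arg_maxnP dp (bD : [pred c | c \notin D] b)) => x' /= x'D deep.
  have hx' : 1 < dp x' by apply: leq_trans (deep b bD); rewrite db.
  have [y' [z' [leafx' y'D y'z y'z' [z'x' nby']]]] :=
    deepest_leaf dpP clD lone x'D hx' deep.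
  apply: (good_pendant_path leafx yz zx nby leafx') => //.
  - by apply/negP=> /(depth_child dpP) x'1; rewrite x'1 in hx'.
  - by apply: contraTneq hx' => ->; rewrite dp0.
  - move=> y'z1 c /nby'[->|->]; [by left | right].
    case/nby': y'z1 => // zx'; by rewrite -zx' dp0 in hx'.
apply: NNPP => bad; have nogood : ~ good z D by move/finish.
have reg v : #|nb v| = d.
  apply/eqP; rewrite eqn_leq deg_ge andbT leqNgt; apply/negP=> big; apply: nogood.
  exact: (good_deg hubD za ab bz aD bD big).
(* If b is the only vertex of T - D at distance at least 2 from z, then T consists
   of two paths of length 2 from z and at most one more leaf at z. *)
case: (classic (exists2 b', b' != b & b' \notin D /\ 1 < dp b')) => [[b' b'b [b'D b'far]]|only].
  have bfar : 1 < dp b by rewrite db.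
  case: (hub_dichotomy hubD dpP b'b b'D bD b'far bfar) => // -[_ multi _ _].
  have /card_gt0P[v _] : 0 < #|G| by move: cardG; clear; lia.
  have [|s [w [vs sw wv nvw]]] := induced_path2 conn (v := v).
    by rewrite reg; move: cardG; clear; lia.
  have [f0 [[stQ pQ QD] fz fa fb]] := prefix3 hubD za ab bz aD bD vs sw wv.
  have [e c eD ec||f pf ff] := greedy_extension stQ pQ QD (D := D).
  - by have := clD e c eD ec; rewrite !inE => /orP[->|->]; rewrite ?orbT.
  - by rewrite (card_hubC hubD).
  have [fz' fb'] : f z = v /\ f b = w by split; rewrite ff ?fz ?fb // !inE eqxx ?orbT.
  have zC : z \in ~: D by rewrite inE.
  have outside : #|f @: (~: D) :\: (v |: nb v)| <= #|nb v :\: f @: (~: D)|.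
    have := @card_outside f (~: D) (~: D) z zC (subxx _).
    by rewrite (card_hubC hubD) fz' reg => /(_ (leqnn _)); rewrite leq_add2l.
  have [u] : exists u, u \in nb v :\: f @: (~: D).
    apply/card_gt0P; apply: leq_trans outside; apply/card_gt0P; exists w.
    by rewrite !inE negb_or wv nvw -fb' imset_f // inE.
  rewrite !inE => /andP[uN vu].
  have [w1 [w2 [w12 w1v w2v nvw1 nvw2]]] := far_pair_regular (reg v).
  (* The free neighbour u of v is adjacent to every non-neighbour of v, so a free one could receive
     x. Hence two non-neighbours of v are used, which yields a second free neighbour. *)
  have inS w' : ~~ edge v w' -> w' \in f @: (~: D).
    move=> nvw'; apply/negPn/negP=> w'N; apply: bad.
    apply: (attach_pendant_path leafx yz zx nby pf (g := u) (g' := w')).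
    - by rewrite fz'.
    - exact: (multi_edge_nb multi vu nvw').
    - by move=> c cD; apply: contraNneq uN => <-; apply: imset_f.
    - by move=> c cD; apply: contraNneq w'N => <-; apply: imset_f.
  apply: nogood; exists f => //; rewrite fz'; apply: leq_trans outside.
  by apply/card_gt1P; exists w1, w2; rewrite !inE !negb_or w1v w2v nvw1 nvw2 !inS.
have [s [v [w [t [t' [[sv sw vw nvw] vt wt' tt' [ts nst t's nst']]]]]]] :=
  two_branches conn reg cardG.
(* The tree path b, a, z, y, x goes to t, v, s, w, t'. *)
have [f0 [[_ pQ QD] fz fa fb]] := prefix3 hubD za ab bz aD bD sv vt ts.
set Q := b |: (a |: [set z]) in pQ QD.
have yD : y \in D by rewrite !inE eqxx orbT.
have xD : x \in D by rewrite !inE eqxx.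
have xy := edge_neq leafx.1.
have notQ e : e \in D -> e \notin Q by move=> eD; apply/negP=> /QD; rewrite eD.
have QE c : c \in Q -> [\/ c = b, c = a | c = z].
  by case/setU1P=> [->|/setU1P[->|/set1P->]]; [apply: Or31 | apply: Or32 | apply: Or33].
have wt : w != t by apply: contraTneq sw => ->.
have t'v : t' != v by apply: contraTneq sv => <-.
have [|c cQ|c cQ|f1 [p1 f1y ff1]] := partial_embedding_add pQ (q := y) (g := w).
- exact: notQ.
- by case/QE: cQ => ->; [rewrite fb eq_sym | rewrite fa | rewrite fz edge_neq].
- by case/nby=> cE; rewrite cE ?fz // in cQ *; move: (QD x cQ); rewrite xD.
have [|c cQ|c cQ|f2 [p2 f2x ff2]] := partial_embedding_add p1 (q := x) (g := t').
- by rewrite in_setU1 negb_or xy notQ.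
- case/setU1P: cQ => [->|cQ]; first by rewrite f1y edge_neq.
  by rewrite ff1 //; case/QE: cQ => ->; [rewrite fb | rewrite fa eq_sym | rewrite fz eq_sym].
- by case: leafx => _ one /one->; rewrite f1y.
have [f2z f2b f2a f2y] : [/\ f2 z = s, f2 b = t, f2 a = v & f2 y = w].
  have f2Q c : c \in Q -> f2 c = f0 c by move=> cQ; rewrite ff2 ?ff1 // setU1r.
  by split; [rewrite f2Q | rewrite f2Q | rewrite f2Q | rewrite ff2 ?setU11];
    rewrite // !inE eqxx ?orbT.
set Q5 := x |: (y |: Q) in p2.
have QsQ5 c : c \notin Q5 -> [/\ c \notin D, c != b, c != a & c != z].
  by rewrite !inE !negb_or => /and5P[-> -> -> -> ->].
have rest c : c \notin Q5 -> leaf_at c z.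
  case/QsQ5=> cD cb ca cz.
  have far0 e : e \notin D -> e != b -> e != z -> edge z e.
    move=> eD eb ez; apply: contraPT only => nze; case; exists e => //.
    by split=> //; apply: (depth_far dpP).
  have zc := far0 c cD cb cz; split=> [|e ce]; first by rewrite edge_sym.
  have dc := depth_child dpP zc; case: (step _ _ ce); rewrite dc.
    by case=> /esym/(depth0 dpP).
  move=> de; have eD : e \notin D.
    apply/negP=> eD; have := clD e c eD; rewrite edge_sym ce => /(_ isT).
    by rewrite !inE (negbTE cz) -in_set2 -/D (negbTE cD).
  have eb : e = b.
    apply/eqP/negPn/negP=> eb; have ez : e != z by rewrite neq // de dp0.
    by have := depth_child dpP (far0 e eD eb ez); rewrite de.
  have bc : edge b c by rewrite -eb edge_sym.
  by case/eqP: ca; apply: (anc b); rewrite ?db ?dc ?da // edge_sym.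
case: (classic (exists l, l \notin Q5)) => [[l lQ]|all]; last first.
  apply: bad; apply: partial_embeddingT (f2) _; apply: partial_embeddingS p2.
  by apply/subsetP=> c _; apply/negPn/negP=> cQ; case: all; exists c.
have full : l |: Q5 = setT.
  apply/setP=> c; rewrite in_setT; apply/setU1P.
  case: (boolP (c \in Q5)) => cQ; [by right | left].
  by apply: (lone c l z); apply: rest.
(* T has six vertices here, so s has a third neighbour besides v and w, which receives the last
   leaf. *)
have d3 : d = 3.
  have := cardsT T; rewrite -full cardsU1 lQ /Q5 cardsU1 in_setU1 negb_or xy notQ //.
  rewrite cardsU1 notQ // /Q !cardsU1 cards1 !inE !negb_or bz eq_sym (edge_neq ab) eq_sym edge_neq //.
  by rewrite cardT; clear; lia.
have [g] : exists g, g \in nb s :\ v :\ w.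
  apply/card_gt0P; have := reg s; rewrite (cardsD1 v) (cardsD1 w) !inE sv sw eq_sym vw d3 /=.
  by clear; lia.
rewrite !inE => /and3P[gw gv sg].
have [c cQ|c cQ|f3 [p3 _ _]] := partial_embedding_add p2 lQ (g := g).
- case/setU1P: cQ => [->|/setU1P[->|/QE[]->]].
  + by rewrite f2x; apply: contraNneq nst' => ->.
  + by rewrite f2y eq_sym.
  + by rewrite f2b; apply: contraNneq nst => ->.
  + by rewrite f2a eq_sym.
  + by rewrite f2z edge_neq.
- by case: (rest l lQ) => _ one /one->; rewrite f2z.
by apply: bad; apply: partial_embeddingT (f3) _; rewrite -full.
Qed.

End Main.

(** * The exceptional pairs do not embed *)

(** Both v2 and v4 lie on one side, so v3 and all p + q leaves, d + 1 vertices in total, would lie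
    on the other side, which has only d. *)
Lemma treeT_bipartite_not_embeds p q d :
  p + q = d -> ~ embeds (treeT p q) (complete_bipartite d d).
Proof.
move=> pq [f injf hom].
pose side (x : 'I_d + 'I_d) := if x is inl _ then true else false.
pose idx (x : 'I_d + 'I_d) := match x with inl i => i | inr i => i end.
have flip x y : @edge (treeT p q) x y -> side (f x) = ~~ side (f y).
  by move/hom; case: (f x); case: (f y).
pose v2 : treeT p q := inl (@Ordinal 3 0 isT).
pose v3 : treeT p q := inl (@Ordinal 3 1 isT).
pose v4 : treeT p q := inl (@Ordinal 3 2 isT).
pose h (o : option ('I_p + 'I_q)) : treeT p q := if o is Some l then inr l else v3.
have h_side o : side (f (h o)) = ~~ side (f v2).
  have s4 : side (f v4) = side (f v2) by rewrite (flip v4 v3) // -(flip v2 v3).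
  by case: o => [[l|l]|]; [apply: flip | rewrite -s4; apply: flip | apply: flip].
have inj_idx x y : side x = side y -> idx x = idx y -> x = y.
  by case: x => i; case: y => j //= _ ->.
have inj : injective (fun o => idx (f (h o))).
  move=> o o' /inj_idx; rewrite !h_side => /(_ erefl)/injf.
  by case: o => [l|]; case: o' => [l'|] // [->].
by have := leq_card _ inj; rewrite card_option card_sum !card_ord pq ltnn.
Qed.

(** The degree of v4 equals that of its image, so the neighbours of v4 fill that neighbourhood. Then
    v1 and v2, not adjacent to v4, both land in the part of its image, although they are
    adjacent. *)
Lemma treeT1_multipartite_not_embeds q k a :
  k * a = q.+1 -> ~ embeds (treeT 1 q) (balanced_multipartite k.+1 a).
Proof.
move=> ka [f injf hom].
pose v1 : treeT 1 q := inr (inl ord0).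
pose v2 : treeT 1 q := inl (@Ordinal 3 0 isT).
pose v3 : treeT 1 q := inl (@Ordinal 3 1 isT).
pose v4 : treeT 1 q := inl (@Ordinal 3 2 isT).
have small : #|nb (f v4)| <= q.+1.
  have := cardsC (nb (f v4)); rewrite card_prod !card_ord mulSn ka addnC.
  suff -> : #|~: nb (f v4)| = a by move/addnI->.
  rewrite -[RHS](card_ord a) -cardsT -[RHS]mul1n -(cards1 (f v4).1) -cardsX.
  by apply: eq_card => -[i j]; rewrite !inE /= /multi_edge /= negbK andbT eq_sym.
have big : q.+1 <= #|nb v4|.
  pose h (o : option 'I_q) : treeT 1 q := if o is Some l then inr (inr l) else v3.
  have inj : injective h by move=> [l|] [l'|] // [->].
  apply: leq_trans (_ : #|h @: setT| <= _).
    by rewrite card_imset // cardsT card_option card_ord.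
  by apply/subset_leq_card/subsetP=> _ /imsetP[[l|] _ ->]; rewrite inE.
have nbE : f @: nb v4 = nb (f v4).
  apply/eqP; rewrite eqEcard card_imset // (leq_trans small big) andbT.
  by apply/subsetP=> _ /imsetP[x x4 ->]; move: x4; rewrite !inE => /hom.
have part x : ~~ edge v4 x -> (f v4).1 = (f x).1.
  move=> n4x; apply/eqP/negPn; rewrite -[_ != _]/(edge (f v4) (f x)) -in_nb -nbE.
  by rewrite mem_imset // in_nb.
have : edge (f v1) (f v2) by apply: hom.
by rewrite /= /multi_edge -(part v1) // -(part v2) // eqxx.
Qed.

(** * Minimum degree and the final equivalence *)

Lemma min_degree_le (G : sgraph) (x : G) : min_degree G <= degree x.
Proof.
rewrite /min_degree; move: (mem_index_enum x); elim: (index_enum G) => // y r IHr.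
rewrite big_cons inE => /predU1P[->|/IHr]; first exact: geq_minl.
by apply: leq_trans; apply: geq_minr.
Qed.

Theorem theorem1p3 (n : nat) (G T : sgraph)
  (n_gt0 : 0 < n)
  (G_conn : connected_graph G)
  (G_card : n <= #|G|)
  (G_deg : n <= min_degree G + 3)
  (T_tree : is_tree T)
  (T_card : #|T| = n)
  (T_deg : max_degree T + 3 <= n) :
  embeds T G <->
    ~ (isomorphic G (complete_bipartite (n - 3) (n - 3)) /\
       exists p : nat,
         [/\ 1 <= p, 1 <= n - 3 - p & isomorphic T (treeT p (n - 3 - p))]) /\
    ~ ((exists k a : nat,
          [/\ 2 <= k, 1 <= a, k * a + 3 = n &
              isomorphic G (balanced_multipartite k.+1 a)]) /\
       isomorphic T (treeT 1 (n - 4))).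
Proof.
split=> [TG|[not_i not_ii]].
  split=> [[isoG [p [p1 q1 isoT]]]|[[k [a [k2 a1 ka isoG]]] isoT]].
    apply: treeT_bipartite_not_embeds (isomorphic_embeds isoT isoG TG).
    by move: q1; clear; lia.
  apply: treeT1_multipartite_not_embeds (isomorphic_embeds isoT isoG TG).
  (* The bound [2 <= k * a] ensures that [n - 4] is not truncated. *)
  by move: (leq_mul k2 a1) ka; clear; lia.
(* The bound on the maximum degree of T gives [3 <= n], so [n - 3] is a genuine difference. *)
have [d nE] : exists d, n = d + 3.
  by exists (n - 3); rewrite subnK // (leq_trans (leq_addl _ _) T_deg).
rewrite nE in G_card G_deg T_card T_deg not_i not_ii.
rewrite !addnK in not_i.
have deg_ge (v : G) : d <= #|nb v|.
  by rewrite leq_add2r in G_deg; apply: leq_trans G_deg (min_degree_le v).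
have deg_le (x : T) : #|nb x| <= d.
  by rewrite leq_add2r in T_deg; apply: leq_trans (leq_bigmax x) T_deg.
case: (classic (forall x x' y : T, leaf_at x y -> leaf_at x' y -> x = x')) => [lone|twins].
  exact: lone_leaves_embeds.
have [x [x' [y [lx lx' xx']]]] : exists x x' y : T, [/\ leaf_at x y, leaf_at x' y & x != x'].
  apply: NNPP => none; case: twins => x x' y lx lx'; apply/eqP/negPn/negP=> xx'.
  by case: none; exists x, x', y.
case: (two_leaves_embeds T_tree G_conn deg_ge G_card T_card deg_le lx lx' xx') => //.
case=> [/not_i//|[[k [a [k2 a1 ka isoG]]] isoT]]; case: not_ii; split.
  by exists k, a; rewrite ka.
by have -> : d + 3 - 4 = d - 1 by clear; lia.
Qed.
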